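(* Let $K$ be a field and $S=K[x_1,\ldots,x_n]$. Let $t\geq 0$ be an integer, and suppose that $\operatorname{depth} S/I\leq\operatorname{sdepth} S/I$ for all monomial ideals $I\subsetneq S$ such that $S/I$ is Cohen--Macaulay of dimension $t$. Then $\operatorname{depth} S/I\leq \operatorname{sdepth} S/I$ for all monomial ideals $I\subsetneq S$ with $\operatorname{depth} S/I=t$. In particular, the inequality $\operatorname{depth} S/I\leq \operatorname{sdepth} S/I$ holds for all monomial ideals $I\subsetneq S$ if and only if it holds for all monomial ideals $I\subsetneq S$ such that $S/I$ is Cohen--Macaulay.
   Context: Stanley depth: let $M$ be a finitely generated $\mathbb{Z}^n$-graded $S$-module, $m\in M$ a nonzero homogeneous element and $Z\subset\{x_1,\ldots,x_n\}$. Let $mK[Z]$ be the $K$-subspace of $M$ generated by all elements $mu$ with $u$ a monomial in $K[Z]$. It is called a Stanley space of dimension $|Z|$ if $mK[Z]$ is a free $K[Z]$-module. A Stanley decomposition $\mathcal{D}$ of $M$ is a decomposition of $M$ (as a $K$-vector space) as a finite direct sum of Stanley spaces. The Stanley depth $\operatorname{sdepth}\mathcal{D}$ is the minimal dimension of a Stanley space in $\mathcal{D}$, and $\operatorname{sdepth} M=\max\{\operatorname{sdepth}\mathcal{D} : \mathcal{D}\text{ is a Stanley decomposition of } M\}$. Stanley's conjecture for a monomial factor algebra $S/I$ ($I$ a monomial ideal) is the inequality $\operatorname{depth} S/I\leq\operatorname{sdepth} S/I$; depth is taken with respect to $(x_1,\ldots,x_n)$. *)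

(* Defs.v *)
From HB Require Import structures.
From Stdlib Require Import ClassicalEpsilon.
From mathcomp Require Import all_boot all_order all_algebra.
From mathcomp Require Import generic_quotient ring_quotient.
From mathcomp Require Import mpoly.

Set Implicit Arguments.
Unset Strict Implicit.
Unset Printing Implicit Defensive.

Import GRing.Theory.
Local Open Scope ring_scope.
Local Open Scope quotient_scope.

(* The value is unspecified when P has no maximum, i.e. when P is empty or    *)
(* unbounded.  For K[x_1, ..., x_n]/I with I a proper ideal contained in      *)
(* (x_1, ..., x_n), the depth, dimension and Stanley depth below are maxima   *)
(* of nonempty sets of natural numbers bounded by n.                          *)
Definition nat_max (P : nat -> Prop) : nat :=
  epsilon (inhabits 0%N) (fun m => P m /\ forall k, P k -> (k <= m)%N).

Definition ideal_gen (R : comNzRingType) (G : R -> Prop) (f : R) : Prop :=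
  exists s : seq (R * R),
    (forall q, q \in s -> G q.2) /\ f = \sum_(q <- s) q.1 * q.2.

Definition krull_dim (R : comNzRingType) : nat :=
  nat_max (fun d => exists P : 'I_d.+1 -> prime_idealr R,
    forall i j : 'I_d.+1, (i < j)%N ->
      {subset P i <= P j} /\ ~ {subset P j <= P i}).

Section QuotientModule.
Variables (R : comNzRingType) (I : idealr R).

Definition quot_scale (a : R) (x : {ideal_quot I}) : {ideal_quot I} :=
  \pi_({ideal_quot I}) a * x.

Lemma quot_scaleA a b x : quot_scale a (quot_scale b x) = quot_scale (a * b) x.
Proof. by rewrite /quot_scale mulrA -rmorphM. Qed.

Lemma quot_scale1 : left_id 1 quot_scale.
Proof. by move=> x; rewrite /quot_scale rmorph1 mul1r. Qed.

Lemma quot_scaleDr : right_distributive quot_scale +%R.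
Proof. by move=> a x y; rewrite /quot_scale mulrDr. Qed.

Lemma quot_scaleDl x : {morph quot_scale^~ x : a b / a + b}.
Proof. by move=> a b; rewrite /quot_scale rmorphD mulrDl. Qed.

HB.instance Definition _ := GRing.Zmodule_isLmodule.Build R {ideal_quot I}
  quot_scaleA quot_scale1 quot_scaleDr quot_scaleDl.
End QuotientModule.

(* x lies in (f_1, ..., f_r) M *)
Definition seq_span (R : comNzRingType) (M : lmodType R) (fs : seq R) (x : M) :
    Prop :=
  exists y : 'I_(size fs) -> M, x = \sum_(i < size fs) fs`_i *: y i.

Definition regular_sequence (R : comNzRingType) (M : lmodType R) (fs : seq R) :
    Prop :=
  (forall i, (i < size fs)%N -> forall x : M,
      seq_span (take i fs) (fs`_i *: x) -> seq_span (take i fs) x) /\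
  (exists x : M, ~ seq_span fs x).

Section MultigradedModules.
Variables (K : fieldType) (n : nat).
Local Notation S := {mpoly K[n]}.

Definition irrelevant_ideal : S -> Prop :=
  ideal_gen (fun g => exists i : 'I_n, g = 'X_i).

(* depth M = grade((x_1, ..., x_n), M) *)
Definition depth (M : lmodType S) : nat :=
  nat_max (fun d => exists fs : seq S,
    [/\ size fs = d, forall f, f \in fs -> irrelevant_ideal f
      & regular_sequence M fs]).

Definition in_subalg (Z : {set 'I_n}) (g : S) : Prop :=
  forall m, m \in msupp g -> forall i, i \notin Z -> m i = 0%N.

(* m K[Z] *)
Definition stanley_span (M : lmodType S) (m : M) (Z : {set 'I_n}) (x : M) :
    Prop :=
  exists2 g : S, in_subalg Z g & x = g *: m.

Section StanleyDepth.
(* The grading enters the definition of sdepth only through the set of        *)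
(* homogeneous elements.                                                      *)
Variables (M : lmodType S) (homogeneous : M -> Prop).

(* m K[Z] is cyclic and K[Z] is a nonzero commutative ring, so for m <> 0     *)
(* freeness says that m is a basis, i.e. has zero annihilator in K[Z].        *)
Definition stanley_space (m : M) (Z : {set 'I_n}) : Prop :=
  [/\ homogeneous m, m != 0
    & forall g : S, in_subalg Z g -> g *: m = 0 -> g = 0].

Definition stanley_decomposition r (D : 'I_r -> M * {set 'I_n}) : Prop :=
  (forall i, stanley_space (D i).1 (D i).2) /\
  (forall x : M, exists! y : {ffun 'I_r -> M},
      (forall i, stanley_span (D i).1 (D i).2 (y i)) /\ x = \sum_i y i).

(* n is neutral here, as all the dimensions are at most n *)
Definition decomposition_sdepth r (D : 'I_r -> M * {set 'I_n}) : nat :=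
  \big[minn/n]_(i < r) #|(D i).2|.

Definition sdepth : nat :=
  nat_max (fun d => exists r (D : 'I_r -> M * {set 'I_n}),
    stanley_decomposition D /\ decomposition_sdepth D = d).
End StanleyDepth.

(* Note that an idealr is by definition a proper ideal. *)
Definition monomial_ideal (I : idealr S) : Prop :=
  exists G : 'X_{1..n} -> Prop,
    forall f : S, f \in I <-> ideal_gen (fun g => exists2 m, G m & g = 'X_[m]) f.

Section Quotient.
Variable I : idealr S.

(* For I a monomial ideal, S/I inherits the Z^n-grading of S, in which the    *)
(* component of degree a is spanned by x^a if a >= 0 and is 0 otherwise.      *)
Definition quot_homogeneous (x : {ideal_quot I}) : Prop :=
  exists (c : K) (m : 'X_{1..n}), x = \pi_({ideal_quot I}) (c *: 'X_[m]).

Definition quot_depth : nat := depth {ideal_quot I}.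
Definition quot_dim : nat := krull_dim {ideal_quot I}.
Definition quot_sdepth : nat := sdepth quot_homogeneous.

Definition quot_CM : Prop := quot_depth = quot_dim.
End Quotient.

End MultigradedModules.

(* Main.v *)
Require Import Defs.
From Stdlib Require Import ClassicalEpsilon FunctionalExtensionality.
From Stdlib Require Import PropExtensionality.
From HB Require Import structures.
From mathcomp Require Import all_boot all_order all_algebra.
From mathcomp Require Import generic_quotient ring_quotient.
From mathcomp Require Import mpoly.
From mathcomp Require Import ring zify.

Set Implicit Arguments.
Unset Strict Implicit.
Unset Printing Implicit Defensive.

Import Order.TTheory GRing.Theory.
Local Open Scope ring_scope.
Local Open Scope quotient_scope.

(** Let I be a monomial ideal with depth S/I = t, and let N >= 1 bound the
    exponents of its minimal generators.  Call a monomial x^a saturated in the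
    variable x_i if a_i >= N.  The cells, i.e. the sets of monomials whose
    exponents have the same truncation c at N, are the monomials of x^c K[Z],
    where Z is the set of variables in which x^c is saturated; every cell lies
    inside or outside I, so the cells outside I decompose S/I into Stanley
    spaces.  Let J be the skeleton ideal, spanned by I and the monomials
    saturated in more than t variables.

    The Stanley depth passes from S/J to S/I (sdepth_skeleton): the monomials of
    J outside I form cells of dimension greater than t, so they extend a Stanley
    decomposition of S/J of Stanley depth at least t to one of S/I.  Since
    Stanley decompositions are equivalent to partitions of the monomials outside
    the ideal into cones (partition_of_decomposition and
    decomposition_of_partition), this is a statement about sets of monomials.

    It remains to see that S/J is Cohen-Macaulay of dimension t
    (skeleton_quotient_CM).  For depth S/J >= t, pass from I to J by adding the
    cells x^c K[Z] in order of decreasing degree of c.  Each step W < W + (x^c)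
    gives an exact sequence 0 -> K[Z] -> S/W -> S/(W + x^c) -> 0 with |Z| > t,
    and the depth lemma keeps depth at least t (depth_ge_enlarge).  Only cyclic
    modules occur, so depth is handled through ideals, and the depth lemma
    (depth_ge_cokernel) reduces to the existence of an element of the maximal
    ideal that is regular on finitely many given cyclic modules
    (common_regular_element), which follows from prime avoidance and
    noetherianity of S.

    For depth S/J <= t and dim S/J <= t, note that a regular sequence and a
    chain of primes both yield elements that are algebraically independent
    modulo J (regular_chain_independent), while more than t elements are
    dependent modulo J, because only O(D ^ t) monomials of degree at most D lie
    outside J (regular_chain_size).  The same count applied to I shows that some
    monomial outside I is saturated in t variables, which gives a chain of t + 1
    monomial primes containing J. *)

Lemma mem_In (T : eqType) (x : T) (s : seq T) : x \in s <-> List.In x s.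
Proof.
elim: s => //= y s <-; rewrite inE.
by split=> [/orP[/eqP->|]|[->|->]]; rewrite ?eqxx ?orbT //; [left|right].
Qed.

(** * Ideals, associated primes and prime avoidance *)

Section Ideals.
Variable R : comNzRingType.
Implicit Types (J P W : R -> Prop) (fs : seq R).

Definition is_ideal J :=
  [/\ J 0, forall a b, J a -> J b -> J (a + b) & forall r a, J a -> J (r * a)].

Definition incl J W := forall a, J a -> W a.

Lemma ideal_ext J W : (forall a, J a <-> W a) -> J = W.
Proof.
move=> JW; apply: functional_extensionality => a.
exact: propositional_extensionality.
Qed.

Definition ideal_adjoin J f : R -> Prop := fun a => exists b, J (a - b * f).
Definition colon J y : R -> Prop := fun a => J (a * y).
Definition regular_mod J f := forall a, J (a * f) -> J a.

Fixpoint ideal_span J fs : R -> Prop :=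
  if fs is f :: fs' then ideal_span (ideal_adjoin J f) fs' else J.

Lemma is_idealN J a : is_ideal J -> J a -> J (- a).
Proof. by case=> _ _ JM Ja; rewrite -mulN1r; apply: JM. Qed.

Lemma is_idealB J a b : is_ideal J -> J a -> J b -> J (a - b).
Proof. by move=> JI Ja Jb; case: (JI) => _ JD _; apply: JD => //; apply: is_idealN. Qed.

Lemma adjoin_ideal J f : is_ideal J -> is_ideal (ideal_adjoin J f).
Proof.
move=> [J0 JD JM]; split.
- by exists 0; rewrite mul0r subr0.
- move=> a b [c Jc] [d Jd]; exists (c + d).
  by have -> : a + b - (c + d) * f = (a - c * f) + (b - d * f); [ring | apply: JD].
- move=> r a [c Jc]; exists (r * c).
  by have -> : r * a - r * c * f = r * (a - c * f); [ring | apply: JM].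
Qed.

Lemma colon_ideal J y : is_ideal J -> is_ideal (colon J y).
Proof.
move=> [J0 JD JM]; split=> [|a b|r a]; rewrite /colon ?mul0r //.
- by rewrite mulrDl; apply: JD.
- by rewrite -mulrA; apply: JM.
Qed.

Lemma sub_adjoin J f : incl J (ideal_adjoin J f).
Proof. by move=> a Ja; exists 0; rewrite mul0r subr0. Qed.

Lemma mem_adjoin J f r : is_ideal J -> ideal_adjoin J f (r * f).
Proof. by case=> J0 _ _; exists r; rewrite subrr. Qed.

Lemma adjoinC J f g :
  ideal_adjoin (ideal_adjoin J f) g = ideal_adjoin (ideal_adjoin J g) f.
Proof.
apply: ideal_ext => a; split=> -[b [c Jc]]; exists c, b; rewrite addrAC //.
Qed.

Lemma span_ideal J fs : is_ideal J -> is_ideal (ideal_span J fs).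
Proof. by elim: fs J => //= f fs IH J JI; apply/IH/adjoin_ideal. Qed.

Lemma sub_span J fs : incl J (ideal_span J fs).
Proof. by elim: fs J => [|f fs IH] J a Ja /=; [|apply/IH/sub_adjoin]. Qed.

Lemma span_mono J W fs : incl J W -> incl (ideal_span J fs) (ideal_span W fs).
Proof.
elim: fs J W => [|f fs IH] J W JW /=; first exact: JW.
by apply: IH => a [b Jb]; exists b; apply: JW.
Qed.

Lemma span_colon J fs p z : is_ideal J -> (forall y, y \in fs -> colon J y p) ->
  ideal_span J fs z -> J (p * z).
Proof.
move=> JI Jp; set W := fun a => J (p * a).
suff sW : incl (ideal_span J fs) W by apply: sW.
have JW : incl J W by move=> a Ja; case: JI => _ _; apply.
have WI : is_ideal W.
  have := colon_ideal p JI; suff -> : colon J p = W by [].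
  by apply: ideal_ext => a; rewrite /colon /W mulrC.
have {Jp} Wf y : y \in fs -> W y by exact: Jp.
move: W JW WI Wf {JI}; elim: fs J => //= f fs IH J W JW WI Wf; apply: IH => //.
  move=> a [b Jb]; rewrite -[a](subrK (b * f)).
  by case: WI => _ WD WM; apply: WD; [apply: JW|apply/WM/Wf; rewrite mem_head].
by move=> y yfs; apply: Wf; rewrite inE yfs orbT.
Qed.

(** The maximal condition on ideals. *)
Definition noetherian := forall F : (R -> Prop) -> Prop,
  (forall J, F J -> is_ideal J) -> (exists J, F J) ->
  exists2 J, F J & forall W, F W -> incl J W -> incl W J.

Definition prime_pred P := is_ideal P /\ forall a b, P (a * b) -> P a \/ P b.

Definition maximal_annihilator J y := ~ J y /\ forall z, ~ J z ->
  incl (colon J y) (colon J z) -> incl (colon J z) (colon J y).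

(** If a y is not in J then (J : a y) contains (J : y), hence equals it. *)
Lemma maximal_annihilator_prime J y :
  is_ideal J -> maximal_annihilator J y -> prime_pred (colon J y).
Proof.
move=> JI [_ ymax]; split=> [|a b Jab]; first exact: colon_ideal.
case: (classic (colon J y a)) => [|Ja]; [by left|right].
apply: (ymax (a * y)) => // [c Jc|]; rewrite /colon.
  by rewrite mulrCA; case: JI => _ _; apply.
by rewrite mulrA [b * a]mulrC.
Qed.

Hypothesis noethR : noetherian.

Lemma sub_maximal_annihilator J a : is_ideal J -> ~ J a ->
  exists2 z, maximal_annihilator J z & incl (colon J a) (colon J z).
Proof.
move=> JI Ja.
pose F W := exists z, [/\ W = colon J z, ~ J z & incl (colon J a) (colon J z)].
case: (@noethR F) => [W [z [-> _ _]]| |W [z [-> Jz az]] Wmax].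
- exact: colon_ideal.
- by exists (colon J a), a; split.
exists z => //; split=> // y Jy zy; apply: Wmax => //.
by exists y; split=> // b /az /zy.
Qed.

(** The maximal annihilators are finite in number: finitely many of the
    annihilated elements generate, modulo J, all the others, and a prime that
    contains a finite intersection of ideals contains one of them. *)
Lemma finite_maximal_annihilators J : is_ideal J ->
  exists2 ys : seq R, forall y, y \in ys -> maximal_annihilator J y &
    forall f a, J (a * f) -> ~ J a -> exists2 y, y \in ys & colon J y f.
Proof.
move=> JI.
pose F W := exists2 ys : seq R,
  W = ideal_span J ys & forall y, y \in ys -> maximal_annihilator J y.
case: (@noethR F) => [W [ys -> _]| |W [ys -> ysmax] Wmax].
- exact: span_ideal.
- by exists J, [::].
exists ys => // f a Jaf Ja.
have [z zmax az] := sub_maximal_annihilator JI Ja.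
have [_ zP] := maximal_annihilator_prime JI zmax.
have Jzf : colon J z f by apply: az; rewrite /colon mulrC.
have zys : ideal_span J ys z.
  apply: (Wmax (ideal_span J (z :: ys))) => /=.
  - by exists (z :: ys) => // y; rewrite inE => /orP[/eqP->|/ysmax].
  - exact/span_mono/sub_adjoin.
  by apply: sub_span; have := mem_adjoin z 1 JI; rewrite mul1r.
case: (classic (exists2 y, y \in ys & incl (colon J y) (colon J z))).
  move=> [y yys yz]; exists y => //; have [_ ymax] := ysmax y yys.
  by apply: (ymax z) => //; case: zmax.
move=> noy; exfalso.
suff [p Jp zp] : exists2 p, forall y, y \in ys -> colon J y p & ~ colon J z p.
  by apply: zp; apply: (span_colon JI Jp zys).
elim: ys noy {ysmax Wmax zys} => [_|y ys IH noy].
  by exists 1 => //; rewrite /colon mul1r; case: zmax.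
have [|p Jp zp] := IH.
  by move=> [x xys xz]; apply: noy; exists x => //; rewrite inE xys orbT.
have [b Jb zb] : exists2 b, colon J y b & ~ colon J z b.
  apply: NNPP => nob; apply: noy; exists y; rewrite ?mem_head // => b Jb.
  by apply: NNPP => zb; apply: nob; exists b.
exists (p * b) => [x|/zP[]//].
rewrite inE => /orP[/eqP->|/Jp Jx].
  by case: (colon_ideal y JI) => _ _; apply.
by rewrite mulrC; case: (colon_ideal x JI) => _ _; apply.
Qed.

Variable m : R -> Prop.
Hypothesis mI : is_ideal m.

(** The classical argument, by induction on the number of primes: correct an
    element that avoids all but one of the primes by an element of m that lies
    in all the others and outside that one. *)
Lemma prime_avoidance (Ps : seq (R -> Prop)) :
  (forall P, List.In P Ps -> prime_pred P /\ ~ incl m P) ->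
  exists2 f, m f & forall P, List.In P Ps -> ~ P f.
Proof.
have [k] := ubnP (size Ps); elim: k Ps => // k IH [|P Ps] /= lek Psm.
  by exists 0 => //; case: mI.
case: (classic (exists2 Q, List.In Q Ps & incl Q P)) => [[Q QPs QP]|noQ].
  (* A prime contained in P need not be avoided separately. *)
  have [Ps1 [Ps2 ePs]] := List.in_split _ _ QPs.
  have sz : (size (P :: Ps1 ++ Ps2) < k)%N.
    by move: lek; rewrite ePs /= !size_cat /= addnS.
  have sub P' : List.In P' (P :: Ps1 ++ Ps2) -> P = P' \/ List.In P' Ps.
    rewrite ePs /= !List.in_app_iff /=; tauto.
  have [f mf fP] := IH _ sz (fun P' h => Psm P' (sub P' h)).
  exists f => // P' [<-|]; first by apply: fP; left.
  rewrite ePs List.in_app_iff /= => -[h|[<-|h]].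
  - by apply: fP; right; apply/List.in_app_iff; left.
  - by move=> /QP; apply: fP; left.
  - by apply: fP; right; apply/List.in_app_iff; right.
have [f mf fP] : exists2 f, m f & forall Q, List.In Q Ps -> ~ Q f.
  by apply: IH => // Q QPs; apply: Psm; right.
case: (classic (P f)) => [Pf|nPf]; last by exists f => // Q [<-|/fP].
have [[PI PP] nmP] := Psm P (or_introl (erefl P)).
have [g [mg nPg gP]] :
    exists g, [/\ m g, ~ P g & forall Q, List.In Q Ps -> Q g].
  have QI Q : List.In Q Ps -> is_ideal Q.
    by move=> h; case: (Psm Q (or_intror h)) => [[]].
  elim: Ps noQ QI {lek Psm fP} => [_ _|Q Ps IHPs noQ QI].
    suff [g mg nPg] : exists2 g, m g & ~ P g by exists g; split.
    by apply: NNPP => nog; apply: nmP => g mg; apply: NNPP => nPg; apply: nog; exists g.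
  have [||g [mg nPg gP]] := IHPs.
  - by case=> Q' h hP; apply: noQ; exists Q' => //; right.
  - by move=> Q' h; apply: QI; right.
  have [q Qq nPq] : exists2 q, Q q & ~ P q.
    apply: NNPP => noq; apply: noQ; exists Q; [by left|move=> q Qq].
    by apply: NNPP => nPq; apply: noq; exists q.
  exists (q * g); split=> [||Q' [<-|h]].
  - by case: mI => _ _; apply.
  - by case/PP.
  - by rewrite mulrC; case: (QI Q (or_introl (erefl Q))) => _ _; apply.
  - by case: (QI Q' (or_intror h)) => _ _ M; apply: M; apply: gP.
exists (f + g) => [|Q [<-|QPs] Qfg]; first by case: mI => _ D _; apply: D.
- by apply: nPg; rewrite -[g](addKr f) addrC; apply: is_idealB.
- have [[QI _] _] := Psm Q (or_intror QPs); apply: (fP Q) => //.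
  by rewrite -[f](addrK g); apply: is_idealB => //; apply: gP.
Qed.

(** This is Hom(R/m, R/J) = 0. *)
Definition socle_free J := forall b, (forall a, m a -> J (a * b)) -> J b.

(** If a maximal annihilator (J : y) contained m, then y would be a nonzero
    socle element of R/J; so all the maximal annihilators, whose union consists
    of the zero divisors, can be avoided simultaneously inside m. *)
Lemma common_regular_element (Js : seq (R -> Prop)) :
  (forall J, List.In J Js -> is_ideal J /\ socle_free J) ->
  exists2 f, m f & forall J, List.In J Js -> regular_mod J f.
Proof.
move=> Jsm.
suff [Ps Psm Psreg] : exists2 Ps : seq (R -> Prop),
    forall P, List.In P Ps -> prime_pred P /\ ~ incl m P &
    forall f, (forall P, List.In P Ps -> ~ P f) ->
      forall J, List.In J Js -> regular_mod J f.
  by have [f mf fP] := prime_avoidance Psm; exists f => //; apply: Psreg.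
elim: Js Jsm => [_|J Js IH Jsm]; first by exists [::].
have [|Ps Psm Psreg] := IH; first by move=> W h; apply: Jsm; right.
have [JI Js0] := Jsm J (or_introl (erefl J)).
have [ys ysmax ysall] := finite_maximal_annihilators JI.
exists (List.map (colon J) ys ++ Ps) => [P|f fP W /= [<-|WJs]].
- rewrite List.in_app_iff List.in_map_iff => -[[y [<- /mem_In yys]]|/Psm //].
  split; first exact/maximal_annihilator_prime/ysmax.
  by move=> my; case: (ysmax _ yys) => + _; apply; apply: Js0 => a /my.
- move=> a Jaf; apply: NNPP => nJa; have [y yys Jyf] := ysall _ _ Jaf nJa.
  apply: (fP (colon J y)) => //; rewrite List.in_app_iff; left.
  by apply: List.in_map; apply/mem_In.
- by apply: Psreg => // P h; apply: fP; rewrite List.in_app_iff; right.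
Qed.

(** * Depth of cyclic modules *)

(** An R/J-regular sequence of length d in m exists.  The unit ideal satisfies
    this for every d, in keeping with the convention that the zero module has
    infinite depth. *)
Fixpoint depth_ge d J : Prop :=
  if d is d'.+1 then
    exists f, [/\ m f, regular_mod J f & depth_ge d' (ideal_adjoin J f)]
  else True.

Lemma depth_ge_socle_free d J : depth_ge d.+1 J -> socle_free J.
Proof. by case=> f [mf freg _] b Jb; apply: freg; rewrite mulrC; apply: Jb. Qed.

Lemma regular_mod_swap J f g : is_ideal J -> regular_mod J f ->
  regular_mod (ideal_adjoin J f) g -> regular_mod (ideal_adjoin J g) f.
Proof.
move=> JI fJ gJ a [b Jb].
have [|c Jc] := gJ b.
  by exists a; rewrite -opprB; apply: is_idealN.
exists c; apply: fJ.
have -> : (a - c * g) * f = (a * f - b * g) + g * (b - c * f) by ring.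
by case: JI => _ JD JM; apply/JD/JM.
Qed.

(** The socle of R/(J + f) is Ext^1(R/m, R/J) for every J-regular f of m, so
    its vanishing does not depend on f. *)
Lemma socle_free_adjoin J f g : is_ideal J -> m f -> regular_mod J f ->
  m g -> regular_mod J g ->
  socle_free (ideal_adjoin J g) -> socle_free (ideal_adjoin J f).
Proof.
move=> JI mf fJ mg gJ gs b Jb; have [_ JD JM] := JI.
have [z Jz] := Jb _ mg.
have [|w Jw] := gs z.
  move=> a /Jb [c Jc]; exists c; apply: fJ.
  have -> : (a * z - c * g) * f = g * (a * b - c * f) - a * (g * b - z * f) by ring.
  by apply: is_idealB => //; apply: JM.
exists w; apply: gJ.
have -> : (b - w * f) * g = (g * b - z * f) + f * (z - w * g) by ring.
by apply/JD/JM.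
Qed.

(** Depth drops by one modulo every regular element f of m, not only modulo the
    element g that witnesses the lower bound: some h in m is regular modulo both
    J + f and J + g, and f and g are compared with it after exchanging the order
    of the two elements, which is where the induction applies. *)
Lemma depth_ge_adjoin d J f : is_ideal J -> depth_ge d.+1 J -> m f ->
  regular_mod J f -> depth_ge d (ideal_adjoin J f).
Proof.
elim: d J f => // d IH J f JI [g [mg gJ gd]] mf fJ.
have JgI := adjoin_ideal g JI; have JfI := adjoin_ideal f JI.
have gs := depth_ge_socle_free gd.
have fs := socle_free_adjoin JI mf fJ mg gJ gs.
have [|h mh hreg] :=
  common_regular_element (Js := [:: ideal_adjoin J g; ideal_adjoin J f]).
  by move=> W /= [<-|[<-|]].
have hg : regular_mod (ideal_adjoin J g) h by apply: hreg; left.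
have hf : regular_mod (ideal_adjoin J f) h by apply: hreg; right; left.
have hd : depth_ge d.+1 (ideal_adjoin J h).
  exists g; split=> //; first exact: regular_mod_swap.
  by rewrite adjoinC; apply: IH.
exists h; split=> //; rewrite adjoinC; apply: IH => //.
- exact: adjoin_ideal.
- exact: regular_mod_swap.
Qed.

(** The depth lemma for 0 -> R/(W : y) -> R/W -> R/(W + y) -> 0.  With t > 0
    the socle of R/(W + y) embeds in Ext^1(R/m, R/(W : y)) = 0, hence some f of
    m is regular on all three modules, and dividing by f gives a sequence of
    the same form. *)
Lemma depth_ge_cokernel t W y : is_ideal W -> depth_ge t.+1 (colon W y) ->
  depth_ge t W -> depth_ge t (ideal_adjoin W y).
Proof.
elim: t W y => // t IH W y WI Qd Wd.
have QI := colon_ideal y WI; have WyI := adjoin_ideal y WI.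
have Qs := depth_ge_socle_free Qd; have Ws := depth_ge_socle_free Wd.
have [_ WD WM] := WI.
have Wys : socle_free (ideal_adjoin W y).
  have [|f mf freg] := common_regular_element (Js := [:: colon W y; W]).
    by move=> V /= [<-|[<-|]].
  have fQ : regular_mod (colon W y) f by apply: freg; left.
  have fW : regular_mod W f by apply: freg; right; left.
  (* Modulo W, f b = a y, where a is killed by m modulo (W : y) + f; hence
     a = c f modulo (W : y), and f b = f c y gives b = c y. *)
  move=> b Wb; have [a Wa] := Wb _ mf.
  have [|c] := depth_ge_socle_free (depth_ge_adjoin QI Qd mf fQ) (b := a).
    move=> g /Wb [a' Wa']; exists a'; rewrite /colon.
    have -> : (g * a - a' * f) * y = f * (g * b - a' * y) - g * (f * b - a * y).
      by ring.
    by apply: is_idealB => //; apply: WM.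
  rewrite /colon => Wc; exists c; apply: fW.
  have -> : (b - c * y) * f = (f * b - a * y) + (a - c * f) * y by ring.
  exact: WD.
have [|f mf freg] :=
  common_regular_element (Js := [:: colon W y; W; ideal_adjoin W y]).
  by move=> V /= [<-|[<-|[<-|]]].
have fQ : regular_mod (colon W y) f by apply: freg; left.
have fW : regular_mod W f by apply: freg; right; left.
have fWy : regular_mod (ideal_adjoin W y) f by apply: freg; right; right; left.
exists f; split=> //; rewrite adjoinC; apply: IH; first exact: adjoin_ideal.
- suff <- : ideal_adjoin (colon W y) f = colon (ideal_adjoin W f) y.
    exact: depth_ge_adjoin.
  apply: ideal_ext => a; split=> -[b]; rewrite /colon.
    by move=> Wb; exists (b * y); have -> : a * y - b * y * f = (a - b * f) * y by ring.
  move=> Wb; have [|c Wc] := fWy b.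
    by exists a; rewrite -opprB; apply: is_idealN.
  exists c; rewrite /colon.
  have -> : (a - c * f) * y = (a * y - b * f) + f * (b - c * y) by ring.
  by apply/WD/WM.
- exact: depth_ge_adjoin.
Qed.

End Ideals.

(** * Noetherianity of polynomial rings *)

Lemma monotone_subsequence (v : nat -> nat) : exists phi : nat -> nat,
  (forall k, phi k < phi k.+1)%N /\ (forall k, v (phi k) <= v (phi k.+1))%N.
Proof.
have argmin N : exists i, (N <= i)%N /\ forall j, (N <= j -> v i <= v j)%N.
  suff H x : forall i, (N <= i)%N -> v i = x ->
    exists i, (N <= i)%N /\ forall j, (N <= j -> v i <= v j)%N.
    exact: (H (v N) N).
  elim/ltn_ind: x => x IH i Ni vi.
  case: (classic (exists2 j, (N <= j)%N & (v j < v i)%N)) => [[j Nj ji]|noj].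
    by apply: (IH (v j) _ j); rewrite -?vi.
  exists i; split=> // j Nj; rewrite leqNgt; apply/negP => ji.
  by apply: noj; exists j.
pose a N := proj1_sig (constructive_indefinite_description _ (argmin N)).
have aP N : (N <= a N)%N /\ forall j, (N <= j -> v (a N) <= v j)%N.
  by rewrite /a; case: constructive_indefinite_description.
exists (fun k => iter k (fun i => a i.+1) (a 0)); split=> k /=.
  by case: (aP (iter k (fun i => a i.+1) (a 0)).+1).
set i := iter k _ _.
have [N [-> Ni]] : exists N, i = a N /\ (N <= a i.+1)%N.
  rewrite {}/i; case: k => [|k] /=; first by exists 0%N.
  eexists; split; first by [].
  set j := iter k _ _; have [h1 _] := aP j.+1.
  by have [h2 _] := aP (a j.+1).+1; apply: leq_trans h2; rewrite ltnW.
by case: (aP N) => _; apply.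
Qed.

Lemma increasing_ltn (phi : nat -> nat) : (forall k, phi k < phi k.+1)%N ->
  forall i j, (i < j)%N -> (phi i < phi j)%N.
Proof.
by move=> phiS; apply: (ssrnat.homo_ltn (r := fun a b => (a < b)%N)) =>
    // y x z; apply: ltn_trans.
Qed.

(** Coordinate by coordinate, pass to a subsequence along which the exponents
    are nondecreasing. *)
Lemma dickson n (u : nat -> 'X_{1..n}) : exists i j, (i < j)%N /\ (u i <= u j)%MM.
Proof.
suff H k : (k <= n)%N -> exists phi : nat -> nat,
  (forall i, phi i < phi i.+1)%N /\
  forall c : 'I_n, (c < k)%N -> forall i, (u (phi i) c <= u (phi i.+1) c)%N.
  have [phi [phiS uphi]] := H n (leqnn n).
  exists (phi 0%N), (phi 1%N); split=> //.
  by apply/mnm_lepP => c; apply: uphi.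
elim: k => [_|k IH kn]; first by exists id; split=> // c; rewrite ltn0.
have [phi [phiS uphi]] := IH (ltnW kn).
have [psi [psiS upsi]] := monotone_subsequence (fun i => u (phi i) (Ordinal kn)).
exists (phi \o psi); split=> [i|c] /=; first exact: increasing_ltn.
rewrite ltnS leq_eqVlt => /orP[/eqP ck i|ck i].
  by have -> : c = Ordinal kn by apply: val_inj.
suff mono : {homo (fun i => u (phi i) c) : i j / (i <= j)%N} by apply/mono/ltnW.
apply: (ssrnat.homo_leq (r := fun a b => (a <= b)%N)) =>
  [//|y x z xy|j]; last exact: uphi.
exact: leq_trans xy.
Qed.

(** Hilbert's basis theorem.  If I_0 < I_1 < ... were strictly increasing, pick
    f_k in I_(k+1) but not in I_k with the least possible leading monomial; by
    Dickson's lemma the leading monomial of some f_i divides that of a later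
    f_j, and cancelling it contradicts the choice of f_j. *)
Theorem mpoly_noetherian (K : fieldType) (n : nat) : noetherian {mpoly K[n]}.
Proof.
move=> F FI [J0 FJ0]; apply: NNPP => nomax.
have next (J : {J | F J}) : exists W : {J | F J},
    incl (sval J) (sval W) /\ exists f, sval W f /\ ~ sval J f.
  case: J => J FJ /=; apply: NNPP => noW; apply: nomax; exists J => // W FW JW f Wf.
  by apply: NNPP => nJf; apply: noW; exists (exist _ W FW); split=> //; exists f.
pose nx J := proj1_sig (constructive_indefinite_description _ (next J)).
pose I k := sval (iter k nx (exist _ J0 FJ0)).
have II k : is_ideal (I k) by apply: FI; rewrite /I; case: (iter _ _ _).
have IS k : incl (I k) (I k.+1) /\ exists f, I k.+1 f /\ ~ I k f.
  rewrite /I /=; set J := iter k _ _; rewrite /nx.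
  by case: constructive_indefinite_description.
have Imono i j : (i <= j)%N -> incl (I i) (I j).
  elim: j => [|j IH]; first by rewrite leqn0 => /eqP->.
  rewrite leq_eqVlt => /orP[/eqP-> //|/IH ij a /ij]; apply: (IS j).1.
pose good k f := [/\ I k.+1 f, ~ I k f &
  forall g, I k.+1 g -> ~ I k g -> ~ (mlead g < mlead f)%O].
have [f fP] : exists f, forall k, good k (f k).
  suff H k : exists f, good k f.
    exists (fun k => proj1_sig (constructive_indefinite_description _ (H k))) => k.
    by case: constructive_indefinite_description.
  have [_ [f [If nIf]]] := IS k; move eml: (mlead f) => l.
  elim/(well_founded_ind (@ltom_wf n)): l f If nIf eml => l IH f If nIf eml.
  case: (classic (exists g, [/\ I k.+1 g, ~ I k g & (mlead g < l)%O])).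
    by move=> [g [Ig nIg gl]]; exact: (IH _ gl g Ig nIg erefl).
  move=> nog; exists f; split=> // g Ig nIg gf; apply: nog; exists g.
  by rewrite -eml.
have f0 k : f k != 0.
  by apply/eqP => fk0; case: (fP k); rewrite fk0; case: (II k).
have [i [j [ij fij]]] := dickson (fun k => mlead (f k)).
(* g is f_j minus the multiple of f_i that cancels its leading term. *)
pose d := (mlead (f j) - mlead (f i))%MM.
pose c := mleadc (f j) / mleadc (f i).
pose q := (c *: 'X_[d]) * f i; pose g := f j - q.
have [Ij nIj jmin] := fP j; have [Ii _ _] := fP i.
have dE : (d + mlead (f i) = mlead (f j))%MM by apply: submK.
have Iq : I j q.
  by case: (II j) => _ _ M; apply: M; apply: (Imono i.+1).
have Ig : I j.+1 g by apply: is_idealB => //; apply: (IS j).1.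
have nIg : ~ I j g.
  move=> h; apply: nIj; rewrite -[f j](subrK q).
  by case: (II j) => _ D _; apply: D.
have g0 : g != 0 by apply/eqP => g0; apply: nIg; rewrite g0; case: (II j).
apply: (jmin g) => //; rewrite lt_neqAle; apply/andP; split.
  apply/eqP => gj; move: g0; rewrite -mleadc_eq0 gj mcoeffB /q -scalerAl mcoeffZ.
  have -> : ('X_[d] * f i)@_(mlead (f j)) = mleadc (f i).
    by rewrite -dE mulrC mcoeffMX.
  rewrite divfK ?subrr ?eqxx //.
  by rewrite mleadc_eq0.
apply: le_trans (mleadB_le _ _) _; rewrite leUx lexx /=.
apply: le_trans (mleadM_le _ _) _; rewrite -dE lemc_add2l.
by apply: le_trans (mleadZ_le _ _) _; rewrite mleadXm.
Qed.

(** * Monomial ideals *)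

Section MonomialIdeals.
Variables (K : fieldType) (n : nat).
Local Notation S := {mpoly K[n]}.
Implicit Types (U V : 'X_{1..n} -> Prop) (a b c : 'X_{1..n}) (f : S).

Definition upset U := forall a b, (a <= b)%MM -> U a -> U b.

Definition monomial_span U : S -> Prop := fun f => forall a, a \in msupp f -> U a.

Lemma monomial_span_ideal U : upset U -> is_ideal (monomial_span U).
Proof.
move=> Uup; split=> [a|f g Uf Ug a|r f Uf a]; first by rewrite msupp0.
- by move/msuppD_le; rewrite mem_cat => /orP[/Uf|/Ug].
- move/msuppM_le/allpairsP => [[b c] /= [_ /Uf Uc ->]].
  exact/(Uup c)/Uc/lem_addl.
Qed.

Lemma monomial_spanX U a : monomial_span U 'X_[a] <-> U a.
Proof.
split=> [|Ua b]; first by apply; rewrite msuppX mem_head.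
by rewrite msuppX inE => /eqP->.
Qed.

Lemma monomial_span_sub U (J : S -> Prop) : is_ideal J ->
  (forall a, U a -> J 'X_[a]) -> incl (monomial_span U) J.
Proof.
move=> [J0 JD JM] JU f Uf; rewrite [f]mpolyE big_seq; apply: (big_ind J) => // a af.
by rewrite -mul_mpolyC; apply/JM/JU/Uf.
Qed.

Lemma monomial_span_ext U V : (forall a, U a <-> V a) ->
  monomial_span U = monomial_span V.
Proof. by move=> UV; apply: ideal_ext => f; split=> h a /h/UV. Qed.

Lemma monomial_span_incl U V :
  (forall a, U a -> V a) -> incl (monomial_span U) (monomial_span V).
Proof. by move=> UV f Uf a /Uf/UV. Qed.

Lemma colonX U c :
  colon (monomial_span U) 'X_[c] = monomial_span (fun b => U (b + c)%MM).
Proof.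
apply: ideal_ext => f; rewrite /colon; split=> Uf a.
  by move=> af; apply: Uf; rewrite mcoeff_msupp addmC mcoeffMX -mcoeff_msupp.
rewrite (perm_mem (msuppMX f c)) => /mapP[b bf ->].
by rewrite addmC; apply: Uf.
Qed.

Lemma adjoinX U c : upset U -> ideal_adjoin (monomial_span U) 'X_[c] =
  monomial_span (fun a => U a \/ (c <= a)%MM).
Proof.
move=> Uup; have UI := monomial_span_ideal Uup.
apply: ideal_ext => f; split=> [[b Ub] a|].
  rewrite -[f](subrK (b * 'X_[c])) => /msuppD_le; rewrite mem_cat => /orP[/Ub Ua|].
    by left.
  by rewrite (perm_mem (msuppMX b c)) => /mapP[d _ ->]; right; apply: lem_addr.
move: f; apply: monomial_span_sub => [|a [Ua|ca]]; first exact: adjoin_ideal.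
  exact/sub_adjoin/monomial_spanX.
by rewrite -(submK ca) mpolyXD; apply: mem_adjoin.
Qed.

Lemma ideal_gen_ideal (R : comNzRingType) (G : R -> Prop) :
  is_ideal (ideal_gen G).
Proof.
split=> [|f g [s [sG ->]] [r [rG ->]]|a f [s [sG ->]]].
- by exists [::]; rewrite big_nil.
- exists (s ++ r); rewrite big_cat; split=> // q.
  by rewrite mem_cat => /orP[/sG|/rG].
- exists [seq (a * q.1, q.2) | q <- s]; split=> [q /mapP[p ps ->]|].
    exact: (sG p).
  by rewrite big_map mulr_sumr; apply: eq_bigr => q _; rewrite mulrA.
Qed.

Lemma ideal_gen_monomials (G : 'X_{1..n} -> Prop) :
  ideal_gen (fun g : S => exists2 m, G m & g = 'X_[m]) =
  monomial_span (fun a => exists2 m, G m & (m <= a)%MM).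
Proof.
apply: ideal_ext => f; split.
  move=> [s [sG ->]]; set U := fun a => _.
  have UI : is_ideal (monomial_span U).
    apply: monomial_span_ideal => a b ab [m Gm ma]; exists m => //.
    exact: lepm_trans ab.
  case: (UI) => U0 UD UM; rewrite big_seq.
  apply: (big_ind (monomial_span U)) => // q /sG[m Gm ->].
  by apply/UM/monomial_spanX; exists m => //; apply: lepm_refl.
move: f; have GI := ideal_gen_ideal (fun g : S => exists2 m, G m & g = 'X_[m]).
apply: monomial_span_sub => // a [m Gm ma]; rewrite -(submK ma) mpolyXD.
case: GI => _ _ GM; apply: GM; exists [:: (1, 'X_[m])]; rewrite big_seq1 mul1r.
by split=> // q; rewrite inE => /eqP->; exists m.
Qed.

Local Notation irr := (@irrelevant_ideal K n).

Lemma irrelevantE : irr = monomial_span (fun a => a <> 0%MM).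
Proof.
rewrite /irrelevant_ideal.
have -> : (fun g : S => exists i : 'I_n, g = 'X_i) =
          (fun g => exists2 m, (exists i, m = U_(i)%MM) & g = 'X_[m]).
  by apply: ideal_ext => g; split=> [[i ->]|[m [i ->] ->]];
    [exists U_(i)%MM => //|]; exists i.
rewrite ideal_gen_monomials; apply: monomial_span_ext => a; split=> [[_ [i ->]]|a0].
  by rewrite lep1mP => ai a0; rewrite a0 mnm0E eqxx in ai.
apply: NNPP => noi; apply: a0; apply/mnmP => i; rewrite mnm0E.
apply/eqP/negPn/negP => ai; apply: noi; exists U_(i)%MM; first by exists i.
by rewrite lep1mP.
Qed.

Lemma irrelevant_is_ideal : is_ideal irr.
Proof. exact: ideal_gen_ideal. Qed.

Lemma irrelevantX i : irr 'X_i.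
Proof.
exists [:: (1, 'X_i)]; rewrite big_seq1 mul1r; split=> // q.
by rewrite inE => /eqP->; exists i.
Qed.

(** The prime generated by the variables outside Z; its quotient is K[Z]. *)
Definition variable_prime (Z : {set 'I_n}) :=
  monomial_span (fun a => exists2 i, i \notin Z & a i != 0%N).

Lemma variable_prime_upset (Z : {set 'I_n}) :
  upset (fun a => exists2 i, i \notin Z & a i != 0%N).
Proof.
move=> a b /mnm_lepP ab [i iZ ai]; exists i => //.
by move: ai; rewrite -!lt0n => ai; apply: leq_trans (ab i).
Qed.

(** The variables in Z form a regular sequence on K[Z]. *)
Lemma variable_prime_depth d (Z : {set 'I_n}) :
  (d <= #|Z|)%N -> depth_ge irr d (variable_prime Z).
Proof.
elim: d Z => // d IH Z dZ.
have [i iZ] : exists i, i \in Z by apply/set0Pn; rewrite -card_gt0 (leq_trans _ dZ).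
exists 'X_i; split; first exact: irrelevantX.
  move=> f; rewrite -/(colon _ _ f) colonX; apply: monomial_span_incl => a [j jZ].
  rewrite mnmDE mnm1E; have -> : (i == j) = false.
    by apply/eqP => ij; rewrite -ij iZ in jZ.
  by rewrite addn0; exists j.
rewrite /variable_prime adjoinX; last exact: variable_prime_upset.
have -> : monomial_span
      (fun a => (exists2 j, j \notin Z & a j != 0%N) \/ (U_(i) <= a)%MM)
   = variable_prime (Z :\ i).
  apply: monomial_span_ext => a; rewrite lep1mP.
  split=> [[[j jZ aj]|ai]|[j]]; [exists j => //| exists i => // |].
  - by rewrite !inE negb_and jZ orbT.
  - by rewrite !inE eqxx.
  by rewrite !inE negb_and negbK => /orP[/eqP->|jZ] aj; [right|left; exists j].
by apply: IH; move: dZ; rewrite (cardsD1 i Z) iZ.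
Qed.

(** * Skeletons *)

Definition cap N a : 'X_{1..n} := [multinom minn (a i) N | i < n].

Lemma capE N a i : cap N a i = minn (a i) N.
Proof. by rewrite mnmE. Qed.

Lemma cap_le N a : (cap N a <= a)%MM.
Proof. by apply/mnm_lepP => i; rewrite capE geq_minl. Qed.

Lemma cap_mono N a b : (a <= b)%MM -> (cap N a <= cap N b)%MM.
Proof.
move/mnm_lepP=> ab; apply/mnm_lepP => i; rewrite !capE.
by have := ab i; lia.
Qed.

Lemma cap_cap N a : cap N (cap N a) = cap N a.
Proof. by apply/mnmP => i; rewrite !capE -minnA minnn. Qed.

Lemma mdeg_cap N a : (mdeg (cap N a) < (n * N).+1)%N.
Proof.
rewrite ltnS mdegE; apply: (@leq_trans (\sum_(i < n) N)).
  by apply: leq_sum => i _; rewrite capE geq_minr.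
by rewrite sum_nat_const card_ord.
Qed.

(** This holds when N bounds the exponents of the minimal generators of U; the
    fibres of cap N, called cells, then lie inside or outside U as a whole. *)
Definition capped N U := upset U /\ forall a, U a -> U (cap N a).

Lemma cappedE N U a : capped N U -> U (cap N a) <-> U a.
Proof. by move=> [Uup Ucap]; split=> [|/Ucap //]; apply/Uup/cap_le. Qed.

(** The ideals spanned by the a with U (cap N a) increase with N and exhaust
    U, so by noetherianity one of them is the whole of U. *)
Lemma exists_cap U : upset U -> exists2 N, (0 < N)%N & capped N U.
Proof.
move=> Uup; pose I N := monomial_span (fun a => U (cap N a)).
have II N : is_ideal (I N).
  by apply: monomial_span_ideal => a b ab; apply/Uup/cap_mono.
pose F J := exists N, J = I N.+1.
have [J [N ->]||_ [N ->] Nmax] := @mpoly_noetherian K n F; first exact: II.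
  by exists (I 1%N), 0%N.
exists N.+1 => //; split=> // a Ua; apply/(monomial_spanX (fun b => U (cap N.+1 b))).
have capdeg M : (mdeg a <= M)%N -> cap M a = a.
  move=> aM; apply/mnmP => i; rewrite capE; apply/minn_idPl.
  by apply: leq_trans aM; rewrite mdegE (bigD1 i) //= leq_addr.
apply: (Nmax (I (N + mdeg a).+1)).
- by exists (N + mdeg a)%N.
- apply: monomial_span_incl => b; apply: Uup; apply/mnm_lepP => i.
  by rewrite !capE; lia.
- by apply/monomial_spanX; rewrite capdeg //; lia.
Qed.

Definition saturated N a : {set 'I_n} := [set i | N <= a i]%N.

Lemma saturated_cap N a : saturated N (cap N a) = saturated N a.
Proof. by apply/setP => i; rewrite !inE capE leq_min leqnn andbT. Qed.

Lemma saturated_mono N a b : (a <= b)%MM -> saturated N a \subset saturated N b.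
Proof.
move/mnm_lepP=> ab; apply/subsetP => i; rewrite !inE => aN.
exact: leq_trans (ab i).
Qed.

(** The monomials of the skeleton ideal of Herzog, Soleyman Jahan and Zheng: a
    monomial outside U that is saturated in Z spans a copy of K[Z] in S/I, and
    the copies of dimension greater than t are killed. *)
Definition skeleton N t U a := U a \/ (t < #|saturated N a|)%N.

Lemma skeleton_capped N t U : capped N U -> capped N (skeleton N t U).
Proof.
move=> [Uup Ucap]; split=> [a b ab|a] [Ua|ta].
- by left; apply: Uup Ua.
- by right; apply: leq_trans ta _; apply/subset_leq_card/saturated_mono.
- by left; apply: Ucap.
- by right; rewrite saturated_cap.
Qed.

Definition as_bool (P : Prop) : bool :=
  if excluded_middle_informative P then true else false.

Lemma as_boolP P : reflect P (as_bool P).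
Proof. by rewrite /as_bool; case: excluded_middle_informative => h; constructor. Qed.

Lemma lem_mdeg_eq a b : (a <= b)%MM -> (mdeg b <= mdeg a)%N -> a = b.
Proof.
move=> ab; rewrite -{1}(submK ab) mdegD -{2}[mdeg a]add0n leq_add2r leqn0 mdeg_eq0.
by move=> /eqP ba0; rewrite -(submK ab) ba0 add0m.
Qed.

(** Lower bounds t for the depth survive the passage from U to a larger V
    whose new monomials are all saturated in more than t variables.  The new
    cells are added by decreasing degree, so that each
    step adds a monomial whose annihilator is the prime of K[Z], |Z| > t, and
    the depth lemma applies. *)
Lemma depth_ge_enlarge N t U V : capped N U -> capped N V ->
  (forall a, U a -> V a) ->
  (forall a, V a -> ~ U a -> (t < #|saturated N a|)%N) ->
  depth_ge irr t (monomial_span U) -> depth_ge irr t (monomial_span V).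
Proof.
pose new U := [pred c : 'X_{1..n < (n * N).+1} |
  as_bool [/\ cap N c = c, V c & ~ U c]].
move=> + Vcap; have [k] := ubnP #|new U|.
elim: k U => // k IH U lek Ucap UV VUt Ut.
case: (pickP (new U)) => [c0 c0new|nonew]; last first.
  suff <- : monomial_span U = monomial_span V by [].
  apply: monomial_span_ext => a; split=> [/UV //|Va].
  apply: NNPP => nUa; have := nonew (BMultinom (mdeg_cap N a)).
  move/as_boolP; apply; rewrite /= cap_cap; split=> //.
    by apply/(cappedE _ Vcap).
  by move/(cappedE _ Ucap).
case: (arg_maxnP (fun c : 'X_{1..n < (n * N).+1} => mdeg c) c0new) => c cnew cmax.
have /as_boolP [cc Vc nUc] := cnew.
have [Uup _] := Ucap; have [Vup _] := Vcap.
have above a : (c <= a)%MM -> cap N a <> c -> U a.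
  move=> ca nca; apply: NNPP => nUa; apply: nca.
  have Va : V (cap N a) by apply/(cappedE _ Vcap)/(Vup c).
  have nU : ~ U (cap N a) by move/(cappedE _ Ucap).
  symmetry; apply: lem_mdeg_eq; first by rewrite -{1}cc cap_mono.
  by apply: (cmax (BMultinom (mdeg_cap N a))); apply/as_boolP; rewrite /= cap_cap.
pose W a := U a \/ cap N a = c.
have WE a : W a <-> U a \/ (c <= a)%MM.
  split=> [[|<-]|[|ca]]; [by left|by right; apply: cap_le|by left|].
  case: (classic (cap N a = c)); first by right.
  by left; apply: above.
have Wcap : capped N W.
  split=> [a b ab /WE[Ua|ca]|a [Ua|ca]]; [| |left|right].
  - by left; apply: Uup Ua.
  - by apply/WE; right; apply: lepm_trans ab.
  - by apply/(cappedE _ Ucap).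
  - by rewrite cap_cap.
apply: (IH W) => //.
- rewrite -ltnS; apply: leq_trans lek; rewrite !ltnS; apply: proper_card.
  apply/properP; split.
    apply/subsetP => a; rewrite !inE => /as_boolP[aa Va nWa].
    by apply/as_boolP; split=> // Ua; apply: nWa; left.
  exists c => //; apply/negP => /as_boolP[_ _]; apply; right; exact: cc.
- by move=> a [/UV //|ca]; apply/(cappedE _ Vcap); rewrite ca.
- by move=> a Va nWa; apply: VUt => // Ua; apply: nWa; left.
rewrite (monomial_span_ext WE) -adjoinX //.
apply: depth_ge_cokernel Ut; first exact: mpoly_noetherian.
- exact: irrelevant_is_ideal.
- exact: monomial_span_ideal.
suff -> : colon (monomial_span U) 'X_[c] = variable_prime (saturated N c).
  exact/variable_prime_depth/VUt.
rewrite colonX; apply: monomial_span_ext => b; split=> [Ubc|[i]].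
  apply: NNPP => nob; apply: nUc; rewrite -cc.
  suff -> : cap N c = cap N (b + c)%MM by apply/(cappedE _ Ucap).
  apply/mnmP => i; rewrite !capE mnmDE.
  have [ci|ci] := leqP N (c i); first by lia.
  suff bi0 : b i = 0%N by lia.
  apply/eqP/negPn/negP => bi; apply: nob; exists i => //.
  by rewrite inE -ltnNge.
rewrite inE -ltnNge => ci bi; apply: above; first exact: lem_addl.
by move/mnmP/(_ i); rewrite capE mnmDE; lia.
Qed.

Lemma depth_ge_skeleton N t U : capped N U ->
  depth_ge irr t (monomial_span U) ->
  depth_ge irr t (monomial_span (skeleton N t U)).
Proof.
move=> Ucap; apply: (@depth_ge_enlarge N) => //; first exact: skeleton_capped.
- by move=> a; left.
- by move=> a [].
Qed.

End MonomialIdeals.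

(** * Lengths of regular chains *)

(** Ideals J = J_0 <= J_1 <= ... <= J_d not containing 1, with f_i in J_i
    regular modulo J_(i-1).  This covers two cases: a regular sequence, with
    J_i = J + (f_1, ..., f_i), and a chain of primes J_i, with f_i in J_i
    outside J_(i-1). *)
Fixpoint regular_chain (R : comNzRingType) (J : R -> Prop) (fs : seq R) : Prop :=
  if fs is f :: fs' then
    regular_mod J f /\
    exists W, [/\ is_ideal W, incl J W, W f & regular_chain W fs']
  else ~ J 1.

Lemma regular_modX (R : comNzRingType) (J : R -> Prop) f k :
  regular_mod J f -> regular_mod J (f ^+ k).
Proof.
move=> fJ; elim: k => [|k IH] a; first by rewrite expr0 mulr1.
by rewrite exprSr mulrA => /fJ/IH.
Qed.

Fixpoint exponents M d : seq (seq nat) :=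
  if d is d'.+1 then [seq a :: e | a <- iota 0 M, e <- exponents M d']
  else [:: [::]].

Lemma size_exponents M d : size (exponents M d) = (M ^ d)%N.
Proof. by elim: d => //= d IH; rewrite size_allpairs size_iota IH expnS. Qed.

Lemma exponents_uniq M d : uniq (exponents M d).
Proof.
elim: d => //= d IH; apply: allpairs_uniq => //; first exact: iota_uniq.
by move=> [a e] [b g] _ _ /= [-> ->].
Qed.

Section Counting.
Variables (K : fieldType) (n : nat).
Local Notation S := {mpoly K[n]}.
Implicit Types (fs : seq S) (e : seq nat) (q : seq nat -> K).

Definition power_product fs e : S := \prod_(p <- zip fs e) p.1 ^+ p.2.

(** The value at fs of the polynomial with coefficients q. *)
Definition eval_at M q fs : S :=
  \sum_(e <- exponents M (size fs)) q e *: power_product fs e.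

Lemma eval_at_cons M q f fs : eval_at M q (f :: fs) =
  \sum_(a < M) f ^+ a * eval_at M (fun e => q (val a :: e)) fs.
Proof.
rewrite /eval_at /= big_allpairs_dep /= -[M in iota 0 M]subn0 big_mkord.
apply: eq_bigr => a _; rewrite mulr_sumr; apply: eq_bigr => e _.
by rewrite /power_product /= big_cons /= scalerAr.
Qed.

(** The elements of a regular chain are algebraically independent modulo its
    first ideal: divide a relation by the largest power of the first element
    that occurs in all its terms, and reduce modulo the next ideal. *)
Lemma regular_chain_independent (J : S -> Prop) M fs q e :
  is_ideal J -> regular_chain J fs -> e \in exponents M (size fs) ->
  q e != 0 -> ~ J (eval_at M q fs).
Proof.
elim: fs J q e => [|f fs IH] J q e JI /=.
  move=> J1; rewrite inE => /eqP-> q0; rewrite /eval_at big_seq1 /power_product.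
  rewrite big_nil => Jq; apply: J1.
  have -> : (1 : S) = (q [::])^-1%:MP * (q [::] *: 1).
    by rewrite mul_mpolyC scalerA mulVf // scale1r.
  by case: JI => _ _; apply.
move=> [fJ [W [WI JW Wf Wfs]]] /allpairsP[[a g] /= [+ gb ->]] qag.
rewrite mem_iota add0n /= => aM.
pose occurs b := has (fun e => q (b :: e) != 0) (exponents M (size fs)).
have ex_occ : exists b, occurs b by exists a; apply/hasP; exists g.
(* b is the least exponent of f in the relation. *)
case: (ex_minnP ex_occ) => b /hasP[h hb qbh] bmin.
have bM : (b < M)%N.
  by apply: leq_ltn_trans aM; apply: bmin; apply/hasP; exists g.
pose ev c := eval_at M (fun e => q (c :: e)) fs.
rewrite eval_at_cons => Jf.
pose r := \sum_(c < M | (b < c)%N) f ^+ (c - b.+1) * ev c.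
have ev0 c : (c < b)%N -> ev c = 0.
  move=> cb; rewrite /ev /eval_at big_seq big1 // => k kM.
  suff /eqP-> : q (c :: k) == 0 by rewrite scale0r.
  apply/negPn/negP => qck; suff : (b <= c)%N by rewrite leqNgt cb.
  by apply: bmin; apply/hasP; exists k.
have e1 : \sum_(c < M) f ^+ c * ev c = (ev b + r * f) * f ^+ b.
  rewrite (bigD1 (Ordinal bM)) //= mulrDl [f ^+ b * _]mulrC; congr (_ + _).
  rewrite (bigID (fun c : 'I_M => (b < c)%N)) /= [X in _ + X]big1 ?addr0.
    rewrite /r 2!mulr_suml; apply: eq_big => [c|c /andP[_ bc]].
      by rewrite -val_eqE /= andb_idl // => bc; rewrite gtn_eqF.
    by rewrite -{1}(subnK bc) -addSnnS addSn exprS exprD; ring.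
  move=> c /andP[]; rewrite -val_eqE /= => cb; rewrite -leqNgt leq_eqVlt.
  rewrite (negbTE cb) /= => /ev0->.
  by rewrite mulr0.
have {}Jf : J (ev b + r * f).
  by apply: (regular_modX (k := b) fJ); rewrite -e1.
apply: (IH W (fun e => q (b :: e)) h) => //.
rewrite -/(ev b) -[ev b](addrK (r * f)); apply: is_idealB => //; first exact: JW.
by case: WI => _ _; apply.
Qed.

Lemma mdeg_coord (a : 'X_{1..n}) i : (a i <= mdeg a)%N.
Proof. by rewrite mdegE (bigD1 i) //= leq_addr. Qed.

Definition degree_le k (f : S) := forall a, a \in msupp f -> (mdeg a <= k)%N.

Lemma degree_leM k l f g : degree_le k f -> degree_le l g -> degree_le (k + l) (f * g).
Proof.
move=> fk gl a /msuppM_le/allpairsP [[b c] /= [/fk bk /gl cl ->]].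
by rewrite mdegD leq_add.
Qed.

Lemma power_product_degree D M fs e : (forall f, f \in fs -> degree_le D f) ->
  e \in exponents M (size fs) ->
  degree_le (size fs * (M * D)) (power_product fs e).
Proof.
have deg1 k : degree_le k 1.
  by move=> a; rewrite -mpolyC1 msupp1 inE => /eqP->; rewrite mdeg0.
elim: fs e => [|f fs IH] e fsD /=.
  by rewrite inE => /eqP-> /=; rewrite /power_product big_nil.
move=> /allpairsP[[b g] /= [+ gb ->]]; rewrite mem_iota add0n /= => bM.
rewrite /power_product /= big_cons mulSn /=; apply: degree_leM; last first.
  by apply: IH => // h hfs; apply: fsD; rewrite inE hfs orbT.
have fbD : degree_le (b * D) (f ^+ b).
  elim: b {bM} => [|b IHb]; first by rewrite expr0.
  by rewrite exprS mulSn; apply: degree_leM => //; apply: fsD; rewrite mem_head.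
by move=> a /fbD ab; apply: leq_trans ab _; rewrite leq_mul2r ltnW ?orbT.
Qed.

(** Choose the set Z of saturated variables; the exponents outside Z are less
    than N, and only those in Z can be as large as L. *)
Lemma card_saturated_le N L t : (0 < N)%N -> (0 < L)%N ->
  (#|[set h : {ffun 'I_n -> 'I_L} | (#|[set i | (N <= h i)%N]| <= t)%N]| <=
   2 ^ n * (N ^ n * L ^ t))%N.
Proof.
move=> N0 L0.
pose F (Z : {set 'I_n}) (i : 'I_n) : pred 'I_L :=
  fun j => (i \in Z) || (j < N)%N.
pose T (Z : {set 'I_n}) : {set {ffun 'I_n -> 'I_L}} :=
  if (#|Z| <= t)%N then [set h in family (F Z)] else set0.
have sub : [set h : {ffun 'I_n -> 'I_L} | (#|[set i | (N <= h i)%N]| <= t)%N]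
    \subset \bigcup_Z T Z.
  apply/subsetP => h; rewrite inE => ht.
  apply/bigcupP; exists [set i | (N <= h i)%N] => //.
  rewrite /T ht inE; apply/familyP => i; rewrite unfold_in inE.
  by case: leqP.
apply: leq_trans (subset_leq_card sub) _.
have cT Z : (#|T Z| <= N ^ n * L ^ t)%N.
  rewrite /T; case: ifP => [Zt|_]; last by rewrite cards0.
  rewrite cardsE card_family foldrE big_map big_enum /=.
  apply: (@leq_trans (\prod_(i : 'I_n) (N * (if i \in Z then L else 1)))).
    apply: leq_prod => i _; case: ifP => iZ.
      apply: leq_trans (max_card _) _; rewrite card_ord.
      by rewrite leq_pmull.
    rewrite muln1 cardE -(size_map val) -[leqRHS](size_iota 0 N).
    apply: uniq_leq_size; first by rewrite map_inj_uniq ?enum_uniq //; apply: val_inj.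
    move=> j /mapP[k]; rewrite mem_enum unfold_in iZ /= => kN ->.
    by rewrite mem_iota.
  rewrite big_split /= prod_nat_const card_ord leq_mul2l -big_mkcond /=.
  by rewrite prod_nat_const leq_pexp2l ?orbT.
apply: (@leq_trans (\sum_(Z : {set 'I_n}) N ^ n * L ^ t)).
  elim/big_ind2: _ => [|A a B b Aa Bb|Z _]; first by rewrite cards0.
    by apply: leq_trans (leq_card_setU _ _).1 _; apply: leq_add.
  exact: cT.
by rewrite sum_nat_const -cardsT -powersetT card_powerset cardsT card_ord.
Qed.

End Counting.

Section Dimension.
Variables (K : fieldType) (n : nat).
Local Notation S := {mpoly K[n]}.
Implicit Types (fs : seq S) (U : 'X_{1..n} -> Prop).

(** Suppose that the chain has d > t elements.  Of the M ^ d monomials in them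
    with exponents less than M, only O(M ^ t) can be linearly independent modulo
    the ideal, as the monomials outside U of degree O(M) are so few; for M large
    this contradicts the algebraic independence of the chain. *)
Theorem regular_chain_size N t U (J : S -> Prop) fs : (0 < N)%N ->
  (forall a, ~ U a -> (#|saturated N a| <= t)%N) ->
  is_ideal J -> incl (monomial_span U) J -> regular_chain J fs ->
  (size fs <= t)%N.
Proof.
move=> N0 Usat JI UJ chain; rewrite leqNgt; apply/negP => td.
set d := size fs in td.
pose D := (\max_(f <- fs) msize f)%N.
have fsD f : f \in fs -> degree_le D f.
  move=> ffs a af; apply: (@leq_trans (msize f)); first exact/ltnW/msize_mdeg_lt.
  by rewrite /D (big_rem f) //= leq_maxl.
pose c := (d * D).+1.
(* L <= M c, so at most 2^n N^n (M c)^t < M^(t+1) monomials of degree less than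
   L lie outside U. *)
pose M := (2 ^ n * N ^ n * c ^ t).+1.
pose L := (d * (M * D)).+1.
set T := [set h : {ffun 'I_n -> 'I_L} | (#|[set i | (N <= h i)%N]| <= t)%N].
pose es := exponents M d.
have TM : (#|T| < size es)%N.
  have LMc : (L <= M * c)%N by rewrite /L /c; nia.
  apply: (@leq_ltn_trans (2 ^ n * (N ^ n * (M * c) ^ t))).
    apply: (leq_trans (card_saturated_le n t N0 (ltn0Sn _))).
    do 2![rewrite leq_mul2l; apply/orP; right].
    by case: (t) => [|k]; rewrite ?expn0 // leq_exp2r.
  rewrite size_exponents; apply: (@leq_trans (M ^ t.+1)); last by rewrite leq_pexp2l.
  have -> : (2 ^ n * (N ^ n * (M * c) ^ t) = (2 ^ n * N ^ n * c ^ t) * M ^ t)%N.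
    by rewrite expnMn; ring.
  by rewrite expnS ltn_pmul2r ?expn_gt0.
pose mon (h : {ffun 'I_n -> 'I_L}) : 'X_{1..n} := [multinom (h i : nat) | i < n].
pose A : 'M[K]_(size es, #|T|) :=
  \matrix_(i, j) (power_product fs (nth [::] es i))@_(mon (enum_val j)).
have : kermx A != 0.
  rewrite -mxrank_eq0 mxrank_ker subn_eq0 -ltnNge.
  exact: leq_ltn_trans (rank_leq_col A) TM.
case/rowV0Pn => v /sub_kermxP vA /rV0Pn[i0 vi0].
pose q e := if insub (index e es) is Some i then v 0 i else 0.
have qE (i : 'I_(size es)) : q (nth [::] es i) = v 0 i.
  by rewrite /q index_uniq ?exponents_uniq // valK.
apply: (regular_chain_independent (M := M) (q := q) (e := nth [::] es i0) _ chain).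
- by [].
- exact: mem_nth.
- by rewrite qE.
apply: UJ => a; rewrite mcoeff_msupp => qa; apply: NNPP => nUa; case/eqP: qa.
rewrite /eval_at -/es (big_nth [::]) big_mkord raddf_sum /=.
under eq_bigr => i _ do rewrite mcoeffZ qE.
have [La|aL] := leqP L (mdeg a).
  rewrite big1 // => i _; rewrite memN_msupp_eq0 ?mulr0 //; apply/negP => ai.
  have := power_product_degree fsD (mem_nth [::] (ltn_ord i)) ai.
  by rewrite leqNgt -/L La.
have aiL i : (a i < L)%N by apply: leq_ltn_trans aL; apply: mdeg_coord.
pose h := [ffun i => Ordinal (aiL i)].
have hT : h \in T.
  rewrite inE; suff -> : [set i | (N <= h i)%N] = saturated N a by apply: Usat.
  by apply/setP => i; rewrite !inE ffunE.
have := congr1 (fun B : 'rV_#|T| => B 0 (enum_rank_in hT h)) vA.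
rewrite !mxE => e0; rewrite -[RHS]e0; apply: eq_bigr => i _; congr (_ * _).
rewrite mxE enum_rankK_in //; congr mcoeff.
by apply/mnmP => j; rewrite mnmE ffunE.
Qed.

End Dimension.

(** * Depth and dimension of monomial quotients *)

Lemma nat_maxE (P : nat -> Prop) m :
  P m -> (forall k, P k -> (k <= m)%N) -> nat_max P = m.
Proof.
move=> Pm Pmax; rewrite /nat_max.
have [Pe emax] := epsilon_spec (inhabits 0%N)
  (fun m => P m /\ forall k, P k -> (k <= m)%N) (ex_intro _ m (conj Pm Pmax)).
by apply/eqP; rewrite eqn_leq Pmax // emax.
Qed.

Lemma nat_maxP (P : nat -> Prop) m N :
  P m -> (forall k, P k -> (k <= N)%N) ->
  P (nat_max P) /\ forall k, P k -> (k <= nat_max P)%N.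
Proof.
move=> Pm Pbound.
suff [M [PM Mmax]] : exists M, P M /\ forall k, P k -> (k <= M)%N.
  by rewrite (nat_maxE PM Mmax).
have [k] := ubnP (N - m); elim: k m Pm => // k IH m Pm lek.
case: (classic (exists2 M, P M & (m < M)%N)) => [[M PM mM]|noM].
  by apply: (IH M) => //; have := Pbound M PM; lia.
exists m; split=> // M PM; rewrite leqNgt; apply/negP => mM.
by apply: noM; exists M.
Qed.

Lemma mem_idealr_ideal (R : comNzRingType) (I : idealr R) :
  is_ideal (fun a => a \in I : Prop).
Proof.
split=> [|a b aI bI|r a aI]; first exact: idealr0.
- exact: rpredD.
- exact: idealMr.
Qed.

Lemma exists_idealr (R : comNzRingType) (J : R -> Prop) : is_ideal J -> ~ J 1 ->
  exists I : idealr R, forall a, a \in I <-> J a.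
Proof.
move=> [J0 JD JM] J1; pose p a := as_bool (J a).
have pI : idealr_closed p.
  split; [exact/as_boolP|by apply/negP => /as_boolP|].
  by move=> a u v /as_boolP Ju /as_boolP Jv; apply/as_boolP/JD/Jv/JM.
pose I : idealr R := HB.pack p (isIdealr.Build R p pI).
have IE a : (a \in I) = as_bool (J a) by [].
by exists I => a; rewrite IE; split=> [/as_boolP|Ja] //; apply/as_boolP.
Qed.

Section QuotientRing.
Variables (R : comNzRingType) (I : idealr R).
Local Notation M := {ideal_quot I}.
Local Notation inI := (fun a => a \in I : Prop).

Lemma quot_eqE a b : \pi_M a = \pi_M b <-> a - b \in I.
Proof. by rewrite Quotient.idealrBE; split=> [->|/eqP]. Qed.

Lemma quot_scaleE f a : f *: \pi_M a = \pi_M (f * a).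
Proof. by rewrite rmorphM. Qed.

Lemma exists_prime_idealr_quot (P : R -> Prop) : prime_pred P -> ~ P 1 ->
  incl inI P -> exists Q : prime_idealr M, forall a, \pi_M a \in Q <-> P a.
Proof.
move=> [PI PP] P1 IP; have [P0 PD PM] := PI.
pose p (x : M) := as_bool (P (repr x)).
have pE a : p (\pi_M a) <-> P a.
  have ar : a - repr (\pi_M a) \in I by apply/quot_eqE; rewrite reprK.
  split=> [/as_boolP Pr|Pa]; last apply/as_boolP.
    by rewrite -[a](subrK (repr (\pi_M a))); apply: PD => //; apply: IP.
  by rewrite -[repr _](subKr a); apply: is_idealB => //; apply: IP.
have pI : idealr_closed p.
  split; [by rewrite -(rmorph0 \pi_M); apply/pE | |].
    by rewrite -(rmorph1 \pi_M); apply/negP => /pE.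
  move=> x y z; rewrite -[x]reprK -[y]reprK -[z]reprK => /pE Py /pE Pz.
  by rewrite -rmorphM -rmorphD; apply/pE/PD/Pz/PM.
have pP : prime_idealr_closed p.
  move=> x y; rewrite -[x]reprK -[y]reprK -rmorphM => /pE/PP[]/pE py; apply/orP.
    by left.
  by right.
pose Q : prime_idealr M :=
  HB.pack p (isIdealr.Build M p pI) (isPrimeIdealrClosed.Build M p pP).
have QE x : (x \in Q) = p x by [].
by exists Q => a; rewrite QE; apply: pE.
Qed.

Lemma ideal_spanP (J : R -> Prop) (fs : seq R) a : ideal_span J fs a <->
  exists y : 'I_(size fs) -> R, J (a - \sum_(i < size fs) fs`_i * y i).
Proof.
elim: fs J a => [|f fs IH] J a /=.
  split=> [Ja|[y]]; last by rewrite big_ord0 subr0.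
  by exists (fun=> 0); rewrite big_ord0 subr0.
split=> [/IH[y [b Jb]]|[y Jy]].
  exists (fun i => if unlift ord0 i is Some j then y j else b).
  rewrite big_ord_recl unlift_none /=; under eq_bigr do rewrite liftK.
  by rewrite [f * b]mulrC opprD addrA addrAC.
apply/IH; exists (fun i => y (lift ord0 i)); exists (y ord0).
by move: Jy; rewrite big_ord_recl /= [f * _]mulrC opprD addrA addrAC.
Qed.

Lemma seq_span_quot (fs : seq R) a :
  seq_span fs (\pi_M a) <-> ideal_span inI fs a.
Proof.
have piS (y : 'I_(size fs) -> R) :
    \pi_M (\sum_(i < size fs) fs`_i * y i) = \sum_(i < size fs) fs`_i *: \pi_M (y i).
  by rewrite rmorph_sum; apply: eq_bigr => i _; rewrite rmorphM.
split=> [[y ya]|/ideal_spanP[y ya]].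
  apply/ideal_spanP; exists (fun i => repr (y i)); apply/quot_eqE.
  by rewrite ya piS; apply: eq_bigr => i _; rewrite reprK.
by exists (fun i => \pi_M (y i)); rewrite -piS; apply/quot_eqE.
Qed.

Fixpoint weakly_regular (J : R -> Prop) (fs : seq R) : Prop :=
  if fs is f :: fs' then
    regular_mod J f /\ weakly_regular (ideal_adjoin J f) fs'
  else True.

Lemma weakly_regularP J (fs : seq R) : weakly_regular J fs <->
  forall i, (i < size fs)%N -> forall a,
    ideal_span J (take i fs) (fs`_i * a) -> ideal_span J (take i fs) a.
Proof.
elim: fs J => [|f fs IH] J /=; first by split.
split=> [[fJ /IH fsreg] [|i] lei a /=|fsreg].
- by rewrite mulrC => /fJ.
- exact: fsreg.
split=> [a Jaf|]; last by apply/IH => i lei; apply: (fsreg i.+1).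
by apply: (fsreg 0%N) => //=; rewrite mulrC.
Qed.

Lemma regular_sequence_quot (fs : seq R) : regular_sequence M fs <->
  weakly_regular inI fs /\ ~ ideal_span inI fs 1.
Proof.
rewrite weakly_regularP; split=> [[fsreg [x xfs]]|[fsreg fs1]].
  split=> [i lei a|].
    by move/seq_span_quot => h; apply/seq_span_quot; apply: fsreg; rewrite ?quot_scaleE.
  have [_ _ fsM] := span_ideal fs (mem_idealr_ideal I).
  move=> fs1; apply: xfs; rewrite -[x]reprK; apply/seq_span_quot.
  by rewrite -[repr x]mulr1; apply: fsM.
split=> [i lei x|]; last by exists (\pi_M 1) => /seq_span_quot.
rewrite -[x]reprK => h; apply/seq_span_quot; apply: fsreg => //.
by apply/seq_span_quot; rewrite -quot_scaleE.
Qed.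

End QuotientRing.

Lemma weakly_regular_chain (R : comNzRingType) (J : R -> Prop) fs : is_ideal J ->
  weakly_regular J fs -> ~ ideal_span J fs 1 -> regular_chain J fs.
Proof.
elim: fs J => //= f fs IH J JI [fJ fsreg] fs1; split=> //.
exists (ideal_adjoin J f); split; last exact/IH/fs1/fsreg/adjoin_ideal.
- exact: adjoin_ideal.
- exact: sub_adjoin.
- by have := mem_adjoin f 1 JI; rewrite mul1r.
Qed.

Lemma depth_geP (R : comNzRingType) (m J : R -> Prop) d : depth_ge m d J <->
  exists fs, [/\ size fs = d, forall f, f \in fs -> m f & weakly_regular J fs].
Proof.
elim: d J => [|d IH] J /=; first by split=> // _; exists [::].
split=> [[f [mf fJ /IH[fs [fsd fsm fsreg]]]]|[[|f fs] [//= [fsd] fsm [fJ fsreg]]]].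
  exists (f :: fs); split=> //=; first by rewrite fsd.
  by move=> g; rewrite inE => /orP[/eqP->|/fsm].
exists f; split=> //; first by apply: fsm; rewrite mem_head.
by apply/IH; exists fs; split=> // g gfs; apply: fsm; rewrite inE gfs orbT.
Qed.

Lemma span_sub (R : comNzRingType) (m J : R -> Prop) fs : is_ideal m ->
  incl J m -> (forall f, f \in fs -> m f) -> incl (ideal_span J fs) m.
Proof.
move=> mI; elim: fs J => [//|f fs IH] J Jm fsm /=; apply: IH => [a [b Jb]|g gfs].
  rewrite -[a](subrK (b * f)); case: mI => _ mD mM; apply: mD; first exact: Jm.
  by apply/mM/fsm; rewrite mem_head.
by apply: fsm; rewrite inE gfs orbT.
Qed.

Section MonomialQuotients.
Variables (K : fieldType) (n : nat).
Local Notation S := {mpoly K[n]}.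
Local Notation irr := (@irrelevant_ideal K n).
Implicit Types (I : idealr S) (U : 'X_{1..n} -> Prop).

Definition monomials_of I U := upset U /\ forall f, f \in I <-> monomial_span U f.

Lemma monomials_of0 I U : monomials_of I U -> ~ U 0%MM.
Proof.
move=> [_ IU] U0; have /negP := negbT (idealr1 I); apply; apply/IU.
by rewrite -mpolyX0; apply/monomial_spanX.
Qed.

Lemma monomials_of_irrelevant I U :
  monomials_of I U -> incl (fun f => f \in I : Prop) irr.
Proof.
move=> IU f /IU.2; rewrite irrelevantE; apply: monomial_span_incl => a Ua a0.
by apply: (monomials_of0 IU); rewrite -a0.
Qed.

Lemma irrelevant1 : ~ irr 1.
Proof.
by rewrite irrelevantE -mpolyX0 => /(@monomial_spanX K n (fun a => a <> 0%MM)).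
Qed.

Lemma monomials_ofE I U : monomials_of I U ->
  (fun f => f \in I : Prop) = monomial_span U.
Proof. by move=> IU; apply: ideal_ext => f; apply: IU.2. Qed.

Lemma monomial_idealP I : monomial_ideal I <-> exists U, monomials_of I U.
Proof.
split=> [[G IG]|[U [Uup IU]]].
  exists (fun a => exists2 g, G g & (g <= a)%MM); split.
    by move=> a b ab [g Gg ga]; exists g => //; apply: lepm_trans ab.
  by move=> f; rewrite -ideal_gen_monomials; apply: IG.
exists U => f; rewrite ideal_gen_monomials.
suff -> : @monomial_span K n (fun a => exists2 m, U m & (m <= a)%MM) =
  monomial_span U by [].
apply: monomial_span_ext => a; split=> [[m Um ma]|Ua]; first exact: Uup Um.
by exists a => //; apply: lepm_refl.
Qed.

Lemma exists_monomial_ideal U : upset U -> ~ U 0%MM -> exists I, monomials_of I U.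
Proof.
move=> Uup U0; have [||I IU] := @exists_idealr S (@monomial_span K n U).
- exact: monomial_span_ideal.
- by rewrite -mpolyX0 => /(@monomial_spanX K n U).
by exists I.
Qed.

Definition quot_depth_ge I d := exists fs : seq S,
  [/\ size fs = d, forall f, f \in fs -> irr f
    & regular_sequence {ideal_quot I} fs].

Lemma quot_depth_geP I U d : monomials_of I U ->
  quot_depth_ge I d <-> depth_ge irr d (monomial_span U).
Proof.
move=> IU; rewrite -(monomials_ofE IU) depth_geP.
split=> [[fs [fsd fsm /regular_sequence_quot[fsreg _]]]|[fs [fsd fsm fsreg]]].
  by exists fs.
exists fs; split=> //; apply/regular_sequence_quot; split=> // fs1.
apply: irrelevant1; apply: span_sub fs1 => //; first exact: irrelevant_is_ideal.
exact: monomials_of_irrelevant IU.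
Qed.

Lemma quot_depth_le I U N t d : monomials_of I U -> (0 < N)%N ->
  (forall a, ~ U a -> (#|saturated N a| <= t)%N) -> quot_depth_ge I d -> (d <= t)%N.
Proof.
move=> IU N0 Usat [fs [<- _ /regular_sequence_quot[fsreg fs1]]].
apply: (regular_chain_size N0 Usat (J := fun f => f \in I : Prop)).
- exact: mem_idealr_ideal.
- by move=> f /IU.2.
by apply: weakly_regular_chain => //; apply: mem_idealr_ideal.
Qed.

Lemma quot_depth_max I U : monomials_of I U ->
  quot_depth_ge I (quot_depth I) /\
  forall d, quot_depth_ge I d -> (d <= quot_depth I)%N.
Proof.
move=> IU; apply: (@nat_maxP (quot_depth_ge I) 0 n).
  by apply/(quot_depth_geP _ IU).
move=> d; apply: (quot_depth_le IU (ltn0Sn 0)) => a _.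
by rewrite -[leqRHS]card_ord max_card.
Qed.

(** An element of P_1 outside the prime P_0 is regular modulo P_0. *)
Lemma prime_chain_regular (R : comNzRingType) d (P : 'I_d.+1 -> R -> Prop) :
  (forall i, prime_pred (P i) /\ ~ P i 1) ->
  (forall i j : 'I_d.+1, (i < j)%N -> incl (P i) (P j) /\ ~ incl (P j) (P i)) ->
  exists2 fs, size fs = d & regular_chain (P ord0) fs.
Proof.
elim: d P => [|d IH] P Pprime Pstrict.
  by exists [::] => //=; have [] := Pprime ord0.
have [||fs fsd fschain] := IH (fun i => P (lift ord0 i)).
- by move=> i; apply: Pprime.
- by move=> i j ij; apply: Pstrict; rewrite !lift0.
set one := lift ord0 ord0 in fschain.
have [P01 P10] := Pstrict ord0 one erefl.
have [f P1f nP0f] : exists2 f, P one f & ~ P ord0 f.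
  by apply: NNPP => nof; apply: P10 => f P1f; apply: NNPP => P0f; apply: nof; exists f.
exists (f :: fs) => /=; first by rewrite fsd.
split; first by move=> a; have [[_ PP] _] := Pprime ord0; case/PP.
exists (P one); split=> //; by have [[]] := Pprime one.
Qed.

Lemma quot_dim_le I U N t d (P : 'I_d.+1 -> prime_idealr {ideal_quot I}) :
  monomials_of I U -> (0 < N)%N ->
  (forall a, ~ U a -> (#|saturated N a| <= t)%N) ->
  (forall i j : 'I_d.+1, (i < j)%N ->
      {subset P i <= P j} /\ ~ {subset P j <= P i}) -> (d <= t)%N.
Proof.
move=> IU N0 Usat Pstrict.
pose Q i (f : S) := \pi_{ideal_quot I} f \in P i.
have Qprime i : prime_pred (Q i) /\ ~ Q i 1.
  split; last by rewrite /Q rmorph1 idealr1.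
  split; last by move=> a b; rewrite /Q rmorphM prime_idealrM => /orP.
  split=> [|a b Qa Qb|r a Qa]; rewrite /Q.
  - by rewrite rmorph0 idealr0.
  - by rewrite rmorphD; apply: rpredD.
  - by rewrite rmorphM; apply: idealMr.
have [|fs fsd chain] := @prime_chain_regular S d Q Qprime.
  move=> i j /Pstrict[PP nPP]; split=> [a /PP //|QQ]; apply: nPP => x.
  by rewrite -[x]reprK => /QQ.
rewrite -fsd; apply: (regular_chain_size N0 Usat _ _ chain).
  by have [[]] := Qprime ord0.
move=> f /IU.2 fI; rewrite /Q.
have -> : \pi_{ideal_quot I} f = \pi_{ideal_quot I} 0.
  by apply/quot_eqE; rewrite subr0.
by rewrite rmorph0 idealr0.
Qed.

(** K[Z] is a domain: the prime is the kernel of the substitution of 0 for the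
    variables outside Z. *)
Lemma variable_prime_prime (Z : {set 'I_n}) : prime_pred (@variable_prime K n Z).
Proof.
have PI : is_ideal (@variable_prime K n Z).
  exact/monomial_span_ideal/variable_prime_upset.
split=> //.
pose phi := comp_mpoly [tuple (if i \in Z then 'X_i else 0 : S) | i < n].
have phiX a : phi 'X_[a] =
    if [forall i, (i \notin Z) ==> (a i == 0%N)] then 'X_[a] else 0.
  rewrite /phi comp_mpolyX; case: ifP => [/forallP aZ|/negbT].
    rewrite [RHS]mpolyXE_id; apply: eq_bigr => i _; rewrite tnth_mktuple.
    by case: ifP => // /negbT iZ; have := aZ i; rewrite iZ => /eqP->; rewrite !expr0.
  rewrite negb_forall => /existsP[i]; rewrite negb_imply => /andP[iZ ai].
  by rewrite (bigD1 i) //= tnth_mktuple (negbTE iZ) expr0n (negbTE ai) mul0r.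
have ker f : variable_prime Z f <-> phi f = 0.
  rewrite {2}[f]mpolyE /phi raddf_sum /=.
  under eq_bigr do rewrite comp_mpolyZ -/phi phiX.
  split=> [Zf|f0 a af].
    rewrite big_seq big1 // => a /Zf[i iZ ai]; case: ifP => [/forallP/(_ i)|_].
      by rewrite iZ (negbTE ai).
    by rewrite scaler0.
  apply: NNPP => noi; move/(congr1 (mcoeff a)): f0.
  rewrite (bigD1_seq a) ?msupp_uniq //= mcoeffD raddf_sum /= big1 => [|b ba].
    rewrite addr0 mcoeff0 mcoeffZ; case: ifP => [_|/negbT].
      by rewrite mcoeffX eqxx mulr1 => /eqP; rewrite mcoeff_eq0 af.
    rewrite negb_forall => /existsP[i]; rewrite negb_imply => /andP[iZ ai].
    by case: noi; exists i.
  rewrite mcoeffZ; case: ifP => _; rewrite ?mcoeff0 ?mulr0 //.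
  by rewrite mcoeffX (negbTE ba) mulr0.
move=> f g /ker; rewrite /phi rmorphM => /eqP; rewrite mulf_eq0.
by move=> /orP[]/eqP/ker; [left|right].
Qed.

Lemma variable_prime1 (Z : {set 'I_n}) : ~ @variable_prime K n Z 1.
Proof.
move=> /(_ 0%MM); rewrite -mpolyC1 msupp1 mem_head => /(_ isT)[i _].
by rewrite mnm0E.
Qed.

(** The primes generated by the variables outside Z', for Z' shrinking from Z
    to the empty set one element at a time. *)
Lemma quot_dim_ge I U (Z : {set 'I_n}) : monomials_of I U ->
  (forall a, U a -> exists2 i, i \notin Z & a i != 0%N) ->
  exists P : 'I_#|Z|.+1 -> prime_idealr {ideal_quot I},
    forall i j : 'I_#|Z|.+1, (i < j)%N ->
      {subset P i <= P j} /\ ~ {subset P j <= P i}.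
Proof.
move=> IU UZ; pose Zs (i : nat) := [set x in drop i (enum Z)].
have ZsZ i : Zs i \subset Z.
  by apply/subsetP => x; rewrite inE => /mem_drop; rewrite mem_enum.
have /fin_all_exists[P PE] : forall i : 'I_#|Z|.+1,
    exists Q : prime_idealr {ideal_quot I},
    forall f, \pi_{ideal_quot I} f \in Q <-> variable_prime (Zs i) f.
  move=> i; apply: exists_prime_idealr_quot.
  - exact: variable_prime_prime.
  - exact: variable_prime1.
  move=> f /IU.2; apply: monomial_span_incl => a /UZ[x xZ ax]; exists x => //.
  by apply: contra xZ; apply/subsetP.
exists P => i j ij; split=> [x|].
  rewrite -[x]reprK => /PE h; apply/PE; move: h.
  apply: monomial_span_incl => a [y yZ ay].
  exists y => //; apply: contra yZ; rewrite !inE -(subnK (ltnW ij)) -drop_drop.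
  exact: mem_drop.
have iZ : (i < size (enum Z))%N by rewrite -cardE; apply: leq_trans ij _; rewrite -ltnS.
have [z0 _] : exists z, z \in Z
  by apply/set0Pn; rewrite -card_gt0 cardE (leq_ltn_trans _ iZ).
set z := nth z0 (enum Z) i.
have zi : z \in Zs i by rewrite inE (drop_nth z0) // mem_head.
have zj : z \notin Zs j.
  have : uniq (take j (enum Z) ++ drop j (enum Z)) by rewrite cat_take_drop enum_uniq.
  rewrite inE cat_uniq.
  case/and3P=> _ /hasPn h _; apply/negP => zd; have /negP := h _ zd; apply.
  by rewrite /= /z -(nth_take z0 ij) mem_nth // size_take; case: ifP => _ //.
move=> /(_ (\pi_{ideal_quot I} 'X_z)) h.
have /PE/monomial_spanX : \pi_{ideal_quot I} 'X_z \in P i.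
  by apply: h; apply/PE/monomial_spanX; exists z => //; rewrite mnm1E eqxx.
by move=> [y yi]; rewrite mnm1E eqb0 negbK => /eqP zy; rewrite -zy zi in yi.
Qed.

(** The depth of S/J is at least t by depth_ge_skeleton; depth and dimension are
    at most t because the monomials outside J are saturated in at most t
    variables.  Were all monomials outside I saturated in fewer than t
    variables, the depth of S/I would be less than t; so some monomial outside I
    is saturated in a set Z of t variables, and the monomial prime of K[Z] starts
    a chain of length t. *)
Theorem skeleton_quotient_CM I U N t J : monomials_of I U -> (0 < N)%N ->
  capped N U -> quot_depth I = t -> monomials_of J (skeleton N t U) ->
  quot_depth J = t /\ quot_dim J = t.
Proof.
move=> IU N0 Ucap It JV.
have [It_ge Imax] := quot_depth_max IU; rewrite It in It_ge.
have Vsat a : ~ skeleton N t U a -> (#|saturated N a| <= t)%N.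
  by move=> nV; rewrite leqNgt; apply/negP => h; apply: nV; right.
have [c nUc ct] : exists2 c, ~ U c & (t <= #|saturated N c|)%N.
  apply: NNPP => noc; case: t It It_ge noc {Vsat JV} => [|t] It It_ge noc.
    by apply: noc; exists 0%MM => //; apply: monomials_of0 IU.
  suff : (t.+1 <= t)%N by rewrite ltnn.
  apply: (quot_depth_le IU N0) It_ge => a nUa.
  by rewrite leqNgt; apply/negP => h; apply: noc; exists a.
have Jt : quot_depth_ge J t.
  by apply/(quot_depth_geP _ JV)/depth_ge_skeleton => //; apply/(quot_depth_geP _ IU).
split; apply: nat_maxE => //.
- by move=> d; apply: (quot_depth_le JV N0).
- have [Z ZS Zt] : exists2 Z : {set 'I_n}, Z \subset saturated N c & #|Z| = t.
    exists [set x in take t (enum (saturated N c))].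
      by apply/subsetP => x; rewrite inE => /mem_take; rewrite mem_enum.
    rewrite cardsE; have /card_uniqP -> := take_uniq t (enum_uniq (saturated N c)).
    by apply: size_takel; rewrite -cardE.
  rewrite -Zt; apply: (quot_dim_ge JV) => a Va; apply: NNPP => noi.
  have aZ i : i \notin Z -> a i = 0%N.
    by move=> iZ; apply/eqP/negPn/negP => ai; apply: noi; exists i.
  case: Va => [Ua|]; last first.
    rewrite ltnNge => /negP; apply; rewrite -Zt; apply/subset_leq_card/subsetP => i.
    rewrite inE => Na; apply/negPn/negP => /aZ a0.
    by rewrite a0 leqNgt N0 in Na.
  apply: nUc; have [Uup _] := Ucap; apply: (Uup (cap N a)); last exact: Ucap.2.
  apply/mnm_lepP => i; rewrite capE; case: (boolP (i \in Z)) => [/(subsetP ZS)|/aZ->].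
    by rewrite inE; apply: leq_trans; apply: geq_minr.
  by rewrite min0n.
- by move=> d [P]; apply: (quot_dim_le JV N0).
Qed.

End MonomialQuotients.

(** * Stanley decompositions as partitions of monomials *)

Section StanleyPartitions.
Variables (K : fieldType) (n : nat).
Local Notation S := {mpoly K[n]}.
Implicit Types (I J : idealr S) (U V : 'X_{1..n} -> Prop) (a b u : 'X_{1..n}).
Implicit Types (Z : {set 'I_n}) (f g h : S).

(** The monomials of x^u K[Z], for p = (u, Z). *)
Definition in_cone (p : 'X_{1..n} * {set 'I_n}) a :=
  (p.1 <= a)%MM && [forall i, (i \notin p.2) ==> (a i == p.1 i)].

Lemma in_coneP u Z a :
  reflect ((u <= a)%MM /\ forall i, i \notin Z -> a i = u i) (in_cone (u, Z) a).
Proof.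
apply: (iffP andP) => /= -[ua h]; split=> //.
  by move=> i iZ; apply/eqP; have /forallP/(_ i)/implyP := h; apply.
by apply/forallP => i; apply/implyP => /h->.
Qed.

Lemma in_cone_add u Z a :
  in_cone (u, Z) (a + u)%MM <-> forall i, i \notin Z -> a i = 0%N.
Proof.
split=> [/in_coneP[_ h] i /h|h]; first by rewrite mnmDE; lia.
by apply/in_coneP; split=> [|i /h]; [apply: lem_addl | rewrite mnmDE => ->].
Qed.

(** The combinatorial form of a Stanley decomposition of S/I. *)
Definition cone_partition U (T : finType) (D : T -> 'X_{1..n} * {set 'I_n}) :=
  [/\ forall t a, in_cone (D t) a -> ~ U a,
      forall a, ~ U a -> exists t, in_cone (D t) a
    & forall a s t, in_cone (D s) a -> in_cone (D t) a -> s = t].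

Lemma quot_eq0 I f : \pi_{ideal_quot I} f = 0 <-> f \in I.
Proof. by rewrite -(rmorph0 \pi_{ideal_quot I}) quot_eqE subr0. Qed.

Lemma mem_msuppMX g u a : (a \in msupp (g * 'X_[u])) =
  (u <= a)%MM && ((a - u)%MM \in msupp g).
Proof.
rewrite (perm_mem (msuppMX g u)); apply/mapP/andP => [[b bg ->]|[ua aug]].
  by rewrite lem_addr addmC addmK.
by exists (a - u)%MM; rewrite // addmC submK.
Qed.

Lemma cone_msupp g u Z a :
  in_subalg Z g -> a \in msupp (g * 'X_[u]) -> in_cone (u, Z) a.
Proof.
move=> gZ; rewrite mem_msuppMX => /andP[ua /gZ h].
by rewrite -(submK ua); apply/in_cone_add.
Qed.

Lemma in_subalgB Z g h : in_subalg Z g -> in_subalg Z h -> in_subalg Z (g - h).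
Proof. by move=> gZ hZ a /msuppB_le; rewrite mem_cat => /orP[/gZ|/hZ]. Qed.

(** Freeness keeps the cones outside U.  They cover the complement of U because
    x^a lies in the sum of the spaces and elements of I have no monomials outside
    U, and they are disjoint by uniqueness of the decomposition. *)
Theorem partition_of_decomposition I U r
    (D : 'I_r -> {ideal_quot I} * {set 'I_n}) :
  monomials_of I U -> stanley_decomposition (@quot_homogeneous K n I) D ->
  exists u : 'I_r -> 'X_{1..n}, cone_partition U (fun i => (u i, (D i).2)).
Proof.
move=> [Uup IU] [Dspace Ddec].
have /fin_all_exists[cu cuE] : forall i, exists p : K * 'X_{1..n},
    (D i).1 = \pi_{ideal_quot I} (p.1 *: 'X_[p.2]).
  by move=> i; have [[c [u ->]] _ _] := Dspace i; exists (c, u).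
pose c i := (cu i).1; pose u i := (cu i).2.
have DE i : (D i).1 = \pi_{ideal_quot I} (c i *: 'X_[u i]) by apply: cuE.
have scaleE i g : g *: (D i).1 = \pi_{ideal_quot I} (c i *: (g * 'X_[u i])).
  by rewrite DE quot_scaleE scalerAr.
have c0 i : c i != 0.
  have [_ + _] := Dspace i; rewrite DE; apply: contra => /eqP->.
  by apply/eqP/quot_eq0; rewrite scale0r idealr0.
have outU i a : in_cone (u i, (D i).2) a -> ~ U a.
  move=> /[dup] /in_coneP[ua _]; rewrite -{1}(submK ua) => /in_cone_add aZ Ua.
  have [_ _ free] := Dspace i.
  have X0 : ('X_[(a - u i)%MM] : S) = 0.
    apply: free => [b|]; first by rewrite msuppX inE => /eqP->.
    rewrite scaleE -mpolyXD submK //; apply/quot_eq0/IU => b.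
    by move/msuppZ_le; rewrite msuppX inE => /eqP->.
  have := msuppX K (a - u i)%MM; by rewrite X0 msupp0.
exists u; split=> [//|a nUa|a i j ai aj].
  have [y [[yspan ysum] _]] := Ddec (\pi_{ideal_quot I} 'X_[a]).
  have /fin_all_exists[g gP] : forall i, exists g,
      in_subalg (D i).2 g /\ y i = g *: (D i).1.
    by move=> i; have [g gZ ->] := yspan i; exists g.
  apply: NNPP => noi; apply: nUa.
  pose f := 'X_[a] - \sum_i c i *: (g i * 'X_[u i]).
  have /IU fI : f \in I.
    apply/quot_eqE; rewrite ysum rmorph_sum; apply: eq_bigr => i _.
    by rewrite (gP i).2 scaleE.
  apply: fI; rewrite mcoeff_msupp mcoeffB mcoeffX eqxx raddf_sum /= big1.
    by rewrite subr0 oner_eq0.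
  move=> i _; rewrite mcoeffZ memN_msupp_eq0 ?mulr0 //; apply/negP => ai.
  by apply: noi; exists i; apply: cone_msupp ai; case: (gP i).
(* The two cones would give x^a two decompositions, y i and y j. *)
apply: NNPP => ij; have aU := outU _ _ ai.
pose y k : {ffun 'I_r -> {ideal_quot I}} :=
  [ffun l => if l == k then \pi_{ideal_quot I} 'X_[a] else 0].
have yP k : in_cone (u k, (D k).2) a ->
  (forall l, stanley_span (D l).1 (D l).2 (y k l)) /\
  \pi_{ideal_quot I} 'X_[a] = \sum_l y k l.
  move=> ak; split=> [l|].
    rewrite ffunE; case: eqP => [->|_]; last first.
      by exists 0; rewrite ?scale0r // => b; rewrite msupp0.
    have /in_coneP[ua _] := ak.
    exists ((c k)^-1 *: 'X_[a - u k]).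
      move=> b /msuppZ_le; rewrite msuppX inE => /eqP->.
      by apply/(in_cone_add (u k)); rewrite submK.
    by rewrite scaleE -scalerAl scalerA mulfV // scale1r -mpolyXD submK.
  rewrite (bigD1 k) //= ffunE eqxx big1 ?addr0 // => l lk.
  by rewrite ffunE (negbTE lk).
have [z [_ zuniq]] := Ddec (\pi_{ideal_quot I} 'X_[a]).
have := congr1 (fun w : {ffun _} => w i)
  (etrans (esym (zuniq _ (yP i ai))) (zuniq _ (yP j aj))).
rewrite !ffunE eqxx; case: eqP => // _ /quot_eq0/IU h.
by apply: aU; apply: h; rewrite msuppX mem_head.
Qed.

Lemma cone_part (p : 'X_{1..n} * {set 'I_n}) f : exists2 g, in_subalg p.2 g &
  forall a, (g * 'X_[p.1])@_a = if in_cone p a then f@_a else 0.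
Proof.
pose part := \sum_(a <- msupp f | in_cone p a) f@_a *: 'X_[a].
pose g := \sum_(a <- msupp f | in_cone p a) f@_a *: 'X_[(a - p.1)%MM].
have gE : g * 'X_[p.1] = part.
  rewrite /g mulr_suml; apply: eq_bigr => a /andP[ua _].
  by rewrite -scalerAl -mpolyXD submK.
have partE a : part@_a = if in_cone p a then f@_a else 0.
  rewrite /part raddf_sum /=; under eq_bigr do rewrite mcoeffZ mcoeffX.
  case: ifP => ap; last first.
    rewrite big1 // => b bp; case: eqP => [ba|_]; last by rewrite mulr0.
    by rewrite -ba bp in ap.
  have [af|af] := boolP (a \in msupp f).
    rewrite big_mkcond (bigD1_seq a) ?msupp_uniq //= ap.
    rewrite eqxx mulr1 big1 ?addr0 // => b /negbTE->.
    by rewrite mulr0 if_same.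
  rewrite (memN_msupp_eq0 af) big_seq_cond big1 // => b /andP[bf _].
  by case: eqP => [ba|_]; rewrite ?mulr0 // -ba bf in af *.
exists g => [a ag i iZ|a]; last by rewrite gE.
have : part@_(a + p.1)%MM != 0 by rewrite -gE addmC mcoeffMX -mcoeff_msupp.
rewrite partE; case: ifP; last by rewrite eqxx.
by case: p iZ {part g gE partE ag} => u Z /= iZ /in_cone_add h _; apply: h.
Qed.

(** The components of an element are the parts of a representative supported in
    the cones; they are unique because no cone meets U or another cone, so that
    a sum of components in I has no monomials. *)
Theorem decomposition_of_partition I U r (D : 'I_r -> 'X_{1..n} * {set 'I_n}) :
  monomials_of I U -> cone_partition U D ->
  stanley_decomposition (@quot_homogeneous K n I)
    (fun i => (\pi_{ideal_quot I} 'X_[(D i).1], (D i).2)).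
Proof.
move=> [Uup IU] [outU cover disj].
have pD i : ((D i).1, (D i).2) = D i by case: (D i).
have cone_supp i g a : in_subalg (D i).2 g -> a \in msupp (g * 'X_[(D i).1]) ->
  in_cone (D i) a by rewrite -{3}(pD i); apply: cone_msupp.
have free i g : in_subalg (D i).2 g -> g * 'X_[(D i).1] \in I -> g = 0.
  move=> gZ /IU gU; apply: msuppnil0; case eg: (msupp g) => [//|a s].
  have ag : (a + (D i).1)%MM \in msupp (g * 'X_[(D i).1]).
    by rewrite mem_msuppMX lem_addl addmK eg mem_head.
  by case: (outU i _ (cone_supp i _ _ gZ ag)); apply: gU.
split=> [i|x].
  split=> /=; first by exists 1, (D i).1; rewrite scale1r.
    apply/eqP => /quot_eq0; rewrite -['X_[_]]mul1r => /free h.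
    have : (1 : S) = 0; last by apply/eqP; rewrite oner_eq0.
    by apply: h => a; rewrite -mpolyC1 msupp1 inE => /eqP-> j _; rewrite mnm0E.
  by move=> g gZ; rewrite quot_scaleE => /quot_eq0/free; apply.
have /fin_all_exists[g gP] : forall i, exists g, in_subalg (D i).2 g /\
    forall a, (g * 'X_[(D i).1])@_a = if in_cone (D i) a then (repr x)@_a else 0.
  by move=> i; have [g gZ gE] := cone_part (D i) (repr x); exists g.
have gsum : \pi_{ideal_quot I} (\sum_i g i * 'X_[(D i).1]) = x.
  rewrite -[RHS]reprK; symmetry.
  apply/quot_eqE/IU => a; rewrite mcoeff_msupp mcoeffB raddf_sum /= => fa.
  apply: NNPP => nUa; have [i ai] := cover a nUa; case/eqP: fa.
  rewrite (bigD1 i) //= (gP i).2 ai big1 ?addr0 ?subrr // => j ji.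
  rewrite (gP j).2; case: ifP => // aj.
  by rewrite (disj _ _ _ aj ai) eqxx in ji.
exists [ffun i => \pi_{ideal_quot I} (g i * 'X_[(D i).1])]; split; [split|].
- by move=> i; rewrite ffunE; exists (g i); [case: (gP i) | rewrite quot_scaleE].
- by rewrite -gsum rmorph_sum; apply: eq_bigr => i _; rewrite ffunE.
move=> y [yspan ysum]; apply/ffunP => i; rewrite ffunE.
have /fin_all_exists[h hP] : forall i, exists h, in_subalg (D i).2 h /\
    y i = \pi_{ideal_quot I} (h * 'X_[(D i).1]).
  by move=> j; have [h hZ ->] := yspan j; exists h; rewrite quot_scaleE.
pose d j := g j - h j.
have dZ j : in_subalg (D j).2 (d j) by apply: in_subalgB; [case: (gP j)|case: (hP j)].
have sumE : \sum_j d j * 'X_[(D j).1] \in I.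
  rewrite /d; under eq_bigr do rewrite mulrBl; rewrite sumrB; apply/quot_eqE.
  by rewrite gsum ysum rmorph_sum; apply: eq_bigr => j _; rewrite (hP j).2.
suff d0 : d i = 0 by rewrite (hP i).2 -[g i](subrK (h i)) -/(d i) d0 add0r.
apply: free => //; apply/IU => a ai; have aD := cone_supp _ _ _ (dZ i) ai.
move/IU: sumE; apply; rewrite mcoeff_msupp raddf_sum /= (bigD1 i) //= big1.
  by rewrite addr0 -mcoeff_msupp.
move=> j ji; apply: memN_msupp_eq0; apply/negP => aj.
by rewrite (disj _ _ _ (cone_supp _ _ _ (dZ j) aj) aD) eqxx in ji.
Qed.

(** A cell is a cone, spanned by the variables in which it is saturated. *)
Lemma in_cone_cell N u a : cap N u = u ->
  in_cone (u, saturated N u) a <-> cap N a = u.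
Proof.
move=> uu; have uN i : (u i <= N)%N by rewrite -uu capE geq_minr.
split=> [/in_coneP[/mnm_lepP ua aZ]|<-].
  apply/mnmP => i; rewrite capE; case: (leqP N (u i)) => iN.
    by have := ua i; have := uN i; lia.
  by rewrite aZ ?inE -?ltnNge //; lia.
apply/in_coneP; split=> [|i]; first exact: cap_le.
by rewrite inE capE; lia.
Qed.

(** The cells of V outside U supply the missing cones. *)
Lemma partition_extend N U V r (D : 'I_r -> 'X_{1..n} * {set 'I_n}) t :
  capped N U -> capped N V -> (forall a, U a -> V a) -> cone_partition V D ->
  (forall i, (t <= #|(D i).2|)%N) ->
  (forall a, V a -> ~ U a -> (t <= #|saturated N a|)%N) ->
  exists s (E : 'I_s -> 'X_{1..n} * {set 'I_n}),
    cone_partition U E /\ forall i, (t <= #|(E i).2|)%N.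
Proof.
move=> Ucap Vcap UV [outV coverV disjV] Dt Vt.
pose cell := {c : 'X_{1..n < (n * N).+1} | as_bool [/\ cap N c = c, V c & ~ U c]}.
pose E0 (x : 'I_r + cell) : 'X_{1..n} * {set 'I_n} := match x with
  | inl i => D i | inr c => (bmnm (val c), saturated N (val c)) end.
have cellP (c : cell) : [/\ cap N (val c) = val c, V (val c) & ~ U (val c)].
  exact/as_boolP/(valP c).
have coneE (c : cell) a : in_cone (E0 (inr c)) a <-> cap N a = val c.
  by have [cc _ _] := cellP c; apply: in_cone_cell.
have E0P : cone_partition U E0.
  split=> [[i|c] a|a nUa|a [i|c] [j|d]].
  - by move=> /outV nVa /UV.
  - by move=> /coneE ac /Ucap.2; rewrite ac; case: (cellP c).
  - case: (classic (V a)) => [Va|/coverV[i ai]]; last by exists (inl i).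
    have cP : as_bool [/\ cap N (cap N a) = cap N a, V (cap N a) & ~ U (cap N a)].
      apply/as_boolP; split; first exact: cap_cap.
        by apply/(cappedE _ Vcap).
      by move/(cappedE _ Ucap).
    pose c : cell := exist _ (BMultinom (mdeg_cap N a)) cP.
    by exists (inr c); apply/coneE.
  - by move=> ai aj; rewrite (disjV _ _ _ ai aj).
  - move=> /outV nVa /coneE ad; case: nVa; apply/(cappedE _ Vcap).
    by rewrite ad; case: (cellP d).
  - move=> /coneE ac /outV nVa; case: nVa; apply/(cappedE _ Vcap).
    by rewrite ac; case: (cellP c).
  - move=> /coneE ac /coneE ad; congr inr; do 2!apply: val_inj.
    by rewrite /= -ac -ad.
have [out cover disj] := E0P.
exists #|{: 'I_r + cell}|, (fun i => E0 (enum_val i)); split; first split.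
- by move=> i a; apply: out.
- by move=> a /cover[x ax]; exists (enum_rank x); rewrite enum_rankK.
- by move=> a i j ai aj; apply: enum_val_inj; apply: disj ai aj.
move=> i; case: (enum_val i) => [j|c] /=; first exact: Dt.
by have [_ Vc Uc] := cellP c; apply: Vt.
Qed.

Lemma bigmin_geP r (F : 'I_r -> nat) t :
  (t <= \big[minn/n]_(i < r) F i)%N <-> (t <= n)%N /\ forall i, (t <= F i)%N.
Proof.
elim: r F => [|r IH] F; first by rewrite big_ord0; split=> [tn|[]] //; split=> // -[].
rewrite big_ord_recl leq_min; split=> [/andP[t0 /IH[tn tF]]|[tn tF]].
  split=> // i; case: (unliftP ord0 i) => [j ->|->]; [exact: tF | exact: t0].
by rewrite tF; apply/IH; split=> [|i]; [exact: tn | exact: tF].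
Qed.

Definition quot_sdepth_eq I d := exists r
  (D : 'I_r -> {ideal_quot I} * {set 'I_n}),
  stanley_decomposition (@quot_homogeneous K n I) D /\ decomposition_sdepth D = d.

Lemma quot_sdepth_max I U : monomials_of I U ->
  quot_sdepth_eq I (quot_sdepth I) /\
  forall d, quot_sdepth_eq I d -> (d <= quot_sdepth I)%N.
Proof.
move=> IU; have [N _ Ucap] := exists_cap K IU.1.
(* All the cells outside U, i.e. the extension of the empty partition. *)
have [|//||//|//|s [E [EU _]]] := @partition_extend N U (fun=> True) 0
  (fun=> (0%MM, set0)) 0 Ucap.
- by [].
- by split=> [[]||a []].
apply: (@nat_maxP (quot_sdepth_eq I) _ n).
  by exists s; eexists; split; first exact: decomposition_of_partition EU.
move=> d [r [D [_ <-]]].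
by have [] := (bigmin_geP (fun i => #|(D i).2|) _).1 (leqnn (decomposition_sdepth D)).
Qed.

(** The monomials of J outside I form cells of dimension greater than t, which
    extend a Stanley decomposition of S/J to one of S/I. *)
Lemma sdepth_skeleton I U N t J : monomials_of I U -> capped N U ->
  monomials_of J (skeleton N t U) -> (t <= quot_sdepth J)%N ->
  (t <= quot_sdepth I)%N.
Proof.
move=> IU Ucap JV tJ; have Vcap := skeleton_capped t Ucap.
have [[r [D [DJ Dd]]] _] := quot_sdepth_max JV.
have [tn Dt] : (t <= n)%N /\ forall i, (t <= #|(D i).2|)%N.
  by apply/bigmin_geP; rewrite -/(decomposition_sdepth D) Dd.
have [u uV] := partition_of_decomposition JV DJ.
have [|||s [E [EU Et]]] := partition_extend Ucap Vcap _ uV (t := t).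
- by move=> a; left.
- exact: Dt.
- by move=> a [//|/ltnW].
pose D' i := (\pi_{ideal_quot I} 'X_[(E i).1], (E i).2).
apply: (@leq_trans (decomposition_sdepth D')); first exact/bigmin_geP.
apply: (quot_sdepth_max IU).2; exists s, D'; split=> //.
exact: decomposition_of_partition IU EU.
Qed.

End StanleyPartitions.

(** * Reduction to the Cohen-Macaulay case *)

Theorem corollary2p2 (K : fieldType) (n : nat) :
  (forall t : nat,
     (forall I : idealr {mpoly K[n]}, monomial_ideal I ->
        quot_CM I -> quot_dim I = t ->
        (quot_depth I <= quot_sdepth I)%N) ->
     forall I : idealr {mpoly K[n]}, monomial_ideal I ->
       quot_depth I = t -> (quot_depth I <= quot_sdepth I)%N)
  /\
  ((forall I : idealr {mpoly K[n]}, monomial_ideal I ->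
      (quot_depth I <= quot_sdepth I)%N)
   <->
   (forall I : idealr {mpoly K[n]}, monomial_ideal I ->
      quot_CM I -> (quot_depth I <= quot_sdepth I)%N)).
Proof.
suff main t : (forall I : idealr {mpoly K[n]}, monomial_ideal I ->
        quot_CM I -> quot_dim I = t -> (quot_depth I <= quot_sdepth I)%N) ->
     forall I : idealr {mpoly K[n]}, monomial_ideal I ->
       quot_depth I = t -> (quot_depth I <= quot_sdepth I)%N.
  split=> //; split=> [all I mI _|allCM I mI]; first exact: all.
  by apply: (main (quot_depth I)) => // J mJ CMJ _; apply: allCM.
move=> CMt I /monomial_idealP[U IU] It.
have [N N0 Ucap] := exists_cap K IU.1.
have [||J JV] := @exists_monomial_ideal K n (skeleton N t U).
- by have [] := skeleton_capped t Ucap.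
- case=> [|]; first exact: monomials_of0 IU.
  suff -> : saturated N (0%MM : 'X_{1..n}) = set0 by rewrite cards0.
  by apply/setP => i; rewrite !inE mnm0E leqNgt N0.
have [Jdepth Jdim] := skeleton_quotient_CM IU N0 Ucap It JV.
rewrite It; apply: (sdepth_skeleton IU Ucap JV); rewrite -[X in (X <= _)%N]Jdepth.
apply: CMt => //; first by apply/monomial_idealP; exists (skeleton N t U).
by rewrite /quot_CM Jdepth Jdim.
Qed.
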